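(* Consider the two-user scalar fading multiple access channel and the Stackelberg game described in the context, and let $\mathcal G_s=\bigcup_{D_1}\{(\bar R_1(D_1,\mathcal P_{1D_1},\mathcal P_{2D_1}),\bar R_2(D_1,\mathcal P_{1D_1},\mathcal P_{2D_1}))\}$, the union over all measurable $D_1\subseteq(0,\infty)^2$. Then $\mathcal G_s$ contains the three boundary points $CR_1$, $CR_2$, $SP$ of the capacity region $\mathcal G_c$, but $\mathcal G_s$ contains no other boundary point of $\mathcal G_c$.
   Context: Channel: $y=\sqrt{h_1}x_1+\sqrt{h_2}x_2+z$, noise variance $\sigma^2>0$; the fading $\mathbf h=(h_1,h_2)$ is stationary ergodic with a stationary distribution on $(0,\infty)^2$ having a continuous bounded density $f$; channel state is known everywhere. User $i$ has power budget $\bar P_i>0$ and feasible set $\mathcal F_i$ of measurable $\mathcal P_i\ge 0$ with $E[\mathcal P_i(\mathbf h)]\le\bar P_i$. For a measurable $D_1\subseteq(0,\infty)^2$ (base station decodes user 1 first on $D_1$, user 2 first on $D_1^c$) the users play the low-level game with payoffs $\bar R_1(D_1,\mathcal P_1,\mathcal P_2)=\iint\tfrac12\log_2\Big(1+\frac{\mathcal P_1h_1}{\sigma^2+\mathcal P_2h_2I_{\{(h_1,h_2)\in D_1\}}}\Big)f\,dh_1dh_2$, $\bar R_2(D_1,\mathcal P_1,\mathcal P_2)=\iint\tfrac12\log_2\Big(1+\frac{\mathcal P_2h_2}{\sigma^2+\mathcal P_1h_1I_{\{(h_1,h_2)\in D_1^c\}}}\Big)f\,dh_1dh_2$, and $(\mathcal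 P_{1D_1},\mathcal P_{2D_1})$ denotes its unique admissible Nash equilibrium (a Nash equilibrium whose payoff pair is not Pareto-dominated by that of another Nash equilibrium). Capacity region $\mathcal G_c$: the set of $(R_1,R_2)$ for which there exist $\mathcal P_i\in\mathcal F_i$ with $R_i\le E[\tfrac12\log_2(1+\mathcal P_ih_i/\sigma^2)]$ ($i=1,2$) and $R_1+R_2\le E[\tfrac12\log_2(1+(\mathcal P_1h_1+\mathcal P_2h_2)/\sigma^2)]$. Its boundary points are its Pareto-optimal points (those maximizing $\mu_1R_1+\mu_2R_2$ over $\mathcal G_c$ for some nonnegative weights, not both zero). $SP$ is the point maximizing $R_1+R_2$. $CR_1$ is the corner point obtained when user 1 water-fills its power against the noise alone, $\mathcal P_1=(\lambda_1-\sigma^2/h_1)^+$, user 2 water-fills against noise plus user 1's interference, $\mathcal P_2=(\lambda_2-(\sigma^2+\mathcal P_1h_1)/h_2)^+$ (water levels $\lambda_i$ chosen to meet the power budgets with equality), and user 2 is decoded first in every state: $CR_1=(E[\tfrac12\log_2(1+\mathcal P_1h_1/\sigma^2)],E[\tfrac12\log_2(1+\mathcal P_2h_2/(\sigma^2+\mathcal P_1h_1))])$. $CR_2$ is defined the same way with the roles of users 1 and 2 exchanged. *)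

(* Defs.v *)
From HB Require Import structures.
From mathcomp Require Import all_boot all_order all_algebra.
From mathcomp Require Import all_classical all_reals all_analysis.
Set Implicit Arguments. Unset Strict Implicit. Unset Printing Implicit Defensive.
Import Order.TTheory GRing.Theory Num.Theory.
Import numFieldNormedType.Exports.
Local Open Scope classical_set_scope.
Local Open Scope ring_scope.

Definition Qpos {R : realType} : set (R * R) := [set h | 0 < h.1 /\ 0 < h.2].

Definition leb2 {R : realType} := (@lebesgue_measure R \x @lebesgue_measure R)%E.

(* expectation w.r.t. the stationary fading distribution with density f *)
Definition Ex {R : realType} (f : R * R -> R) (g : R * R -> R) : \bar R :=
  (\int[leb2]_(h in Qpos) (g h * f h)%:E)%E.

Definition log2 {R : realType} (x : R) : R := ln x / ln 2.

Definition feasible {R : realType} (f : R * R -> R) (Pb : R) (P : R * R -> R) :=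
  [/\ measurable_fun Qpos P, (forall h, Qpos h -> 0 <= P h) & (Ex f P <= Pb%:E)%E].

(* low-level game payoffs for decoding region D1 (user 1 decoded first on D1) *)
Definition rate1 {R : realType} (f : R * R -> R) (s2 : R) (D1 : set (R * R))
  (P1 P2 : R * R -> R) : \bar R :=
  Ex f (fun h => 2^-1 * log2 (1 + P1 h * h.1 / (s2 + P2 h * h.2 * \1_D1 h))).

Definition rate2 {R : realType} (f : R * R -> R) (s2 : R) (D1 : set (R * R))
  (P1 P2 : R * R -> R) : \bar R :=
  Ex f (fun h => 2^-1 * log2 (1 + P2 h * h.2 / (s2 + P1 h * h.1 * \1_(~` D1) h))).

Definition is_NE {R : realType} (f : R * R -> R) (s2 Pb1 Pb2 : R)
  (D1 : set (R * R)) (P1 P2 : R * R -> R) :=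
  [/\ feasible f Pb1 P1, feasible f Pb2 P2,
      (forall P1', feasible f Pb1 P1' -> (rate1 f s2 D1 P1' P2 <= rate1 f s2 D1 P1 P2)%E)
    & (forall P2', feasible f Pb2 P2' -> (rate2 f s2 D1 P1 P2' <= rate2 f s2 D1 P1 P2)%E)].

Definition pareto_dom {R : realType} (a b : \bar R * \bar R) :=
  [/\ (b.1 <= a.1)%E, (b.2 <= a.2)%E & ((b.1 < a.1)%E \/ (b.2 < a.2)%E)].

Definition admissible_NE {R : realType} (f : R * R -> R) (s2 Pb1 Pb2 : R)
  (D1 : set (R * R)) (P1 P2 : R * R -> R) :=
  is_NE f s2 Pb1 Pb2 D1 P1 P2 /\
  ~ (exists Q1 Q2, is_NE f s2 Pb1 Pb2 D1 Q1 Q2 /\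
       pareto_dom (rate1 f s2 D1 Q1 Q2, rate2 f s2 D1 Q1 Q2)
                  (rate1 f s2 D1 P1 P2, rate2 f s2 D1 P1 P2)).

Definition Gs {R : realType} (f : R * R -> R) (s2 Pb1 Pb2 : R) : set (R * R) :=
  [set p | exists D1 P1 P2,
     [/\ measurable D1, D1 `<=` Qpos, admissible_NE f s2 Pb1 Pb2 D1 P1 P2,
         p.1%:E = rate1 f s2 D1 P1 P2 & p.2%:E = rate2 f s2 D1 P1 P2]].

Definition Gc {R : realType} (f : R * R -> R) (s2 Pb1 Pb2 : R) : set (R * R) :=
  [set p | exists P1 P2,
     [/\ feasible f Pb1 P1, feasible f Pb2 P2,
         (p.1%:E <= Ex f (fun h => (2^-1 * log2 (1 + P1 h * h.1 / s2))%R))%E,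
         (p.2%:E <= Ex f (fun h => (2^-1 * log2 (1 + P2 h * h.2 / s2))%R))%E
       & ((p.1 + p.2)%:E <=
            Ex f (fun h => (2^-1 * log2 (1 + (P1 h * h.1 + P2 h * h.2) / s2))%R))%E]].

Definition boundary_Gc {R : realType} (f : R * R -> R) (s2 Pb1 Pb2 : R) (p : R * R) :=
  Gc f s2 Pb1 Pb2 p /\
  exists mu1 mu2 : R, [/\ 0 <= mu1, 0 <= mu2, (mu1 != 0) || (mu2 != 0) &
    forall q, Gc f s2 Pb1 Pb2 q -> mu1 * q.1 + mu2 * q.2 <= mu1 * p.1 + mu2 * p.2].

Definition is_SP {R : realType} (f : R * R -> R) (s2 Pb1 Pb2 : R) (p : R * R) :=
  Gc f s2 Pb1 Pb2 p /\ forall q, Gc f s2 Pb1 Pb2 q -> q.1 + q.2 <= p.1 + p.2.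

(* CR_1 : user 1 water-fills against noise, user 2 against noise + user 1;
   user 2 decoded first in every state *)
Definition is_CR1 {R : realType} (f : R * R -> R) (s2 Pb1 Pb2 : R) (p : R * R) :=
  exists l1 l2 : R,
    let P1 := fun h : R * R => Num.max (l1 - s2 / h.1) 0 in
    let P2 := fun h : R * R => Num.max (l2 - (s2 + P1 h * h.1) / h.2) 0 in
    [/\ Ex f P1 = Pb1%:E, Ex f P2 = Pb2%:E,
        p.1%:E = Ex f (fun h => 2^-1 * log2 (1 + P1 h * h.1 / s2))
      & p.2%:E = Ex f (fun h => 2^-1 * log2 (1 + P2 h * h.2 / (s2 + P1 h * h.1)))].

Definition is_CR2 {R : realType} (f : R * R -> R) (s2 Pb1 Pb2 : R) (p : R * R) :=
  exists l1 l2 : R,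
    let P2 := fun h : R * R => Num.max (l2 - s2 / h.2) 0 in
    let P1 := fun h : R * R => Num.max (l1 - (s2 + P2 h * h.2) / h.1) 0 in
    [/\ Ex f P1 = Pb1%:E, Ex f P2 = Pb2%:E,
        p.1%:E = Ex f (fun h => 2^-1 * log2 (1 + P1 h * h.1 / (s2 + P2 h * h.2)))
      & p.2%:E = Ex f (fun h => 2^-1 * log2 (1 + P2 h * h.2 / s2))].

(* Main.v *)
(** Every best response is a water-filling policy [(l - n / g)+] against the
    noise-to-gain ratio it faces; the tangent line of the logarithm at this
    policy shows that it is optimal, and unique up to null states.

    Whatever the decoding set, the two rates of the game add up to
    [E (1/2 log2 (1 + (P1 h1 + P2 h2) / s2))].  If the pair of an equilibrium
    maximises [mu1 R1 + mu2 R2] with [mu1 > mu2 >= 0], then the first rate must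
    be interference free, that is, at most one user is active on the decoding
    set.  When [mu2 = 0] the first policy is thus the single-user water-filling
    and the pair is [CR_1].  When [mu2 > 0], on the states where both users are
    active the two water-level equations determine [s2 + P1 h1] and
    [s2 + P1 h1 + P2 h2], so that the marginal value of the first power is
    strictly monotone in [h2 / h1]; this ratio has no atoms, so a transfer of
    power would improve the objective unless these states are null.  The two
    policies are then orthogonal and jointly water-filling, hence [SP].

    At [SP] the policies are orthogonal for the same atomlessness reason, and
    decoding user 1 first exactly where user 2 is active makes them an
    equilibrium.  No equilibrium dominates it, since the sum rate is maximal. *)
Require Import Defs.
From HB Require Import structures.
From mathcomp Require Import all_boot all_order all_algebra.
From mathcomp Require Import all_classical all_reals all_analysis.
From mathcomp Require Import measurable_realfun ring lra.
Set Implicit Arguments. Unset Strict Implicit. Unset Printing Implicit Defensive.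
Import Order.TTheory GRing.Theory Num.Theory.
Import numFieldNormedType.Exports.
Local Open Scope classical_set_scope.
Local Open Scope ring_scope.

(** * Scalar inequalities *)

Section real_inequalities.
Context {R : realType}.

Lemma ln_le_sub1 (t : R) : 0 < t -> ln t <= t - 1.
Proof. by move=> t0; have := expR_ge1Dx (ln t); rewrite lnK ?posrE//; lra. Qed.

Lemma ln_eq_sub1 (t : R) : 0 < t -> ln t = t - 1 -> t = 1.
Proof.
move=> t0 e; apply/eqP/negPn/negP => t1.
have : ln t != 0 by rewrite ln_eq0.
by move=> /expR_gt1Dx; rewrite lnK ?posrE//; lra.
Qed.

Lemma le_add_eq (x y a b : R) :
  x <= a -> y <= b -> a + b <= x + y -> a = x /\ b = y.
Proof. by move=> xa yb ab; split; lra. Qed.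

Lemma ln2_gt0 : 0 < ln 2 :> R. Proof. by apply: ln_gt0; lra. Qed.

Lemma ln_tangent_le (x y : R) : 0 < x -> 0 < y -> ln y <= ln x + (y - x) / x.
Proof.
move=> x0 y0; have := ln_le_sub1 (divr_gt0 y0 x0).
by rewrite ln_div ?posrE// mulrBl divff ?gt_eqF//; lra.
Qed.

Lemma ln_tangent_eq (x y : R) :
  0 < x -> 0 < y -> ln y = ln x + (y - x) / x -> y = x.
Proof.
move=> x0 y0 e; have := @ln_eq_sub1 (y / x) (divr_gt0 y0 x0).
rewrite ln_div ?posrE// e => H.
have /H : ln x + (y - x) / x - ln x = y / x - 1.
  by rewrite mulrBl divff ?gt_eqF//; lra.
by move=> /(congr1 ( *%R^~ x)); rewrite mulfVK ?gt_eqF// mul1r.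
Qed.

Lemma log2_le (x y : R) : 0 < x -> x <= y -> log2 x <= log2 y.
Proof.
move=> x0 xy; rewrite ler_wpM2r ?invr_ge0 ?(ltW ln2_gt0)//.
by rewrite ler_ln ?posrE// (lt_le_trans x0).
Qed.

Lemma log2_inj (x y : R) : 0 < x -> 0 < y -> log2 x = log2 y -> x = y.
Proof.
move=> x0 y0 /(congr1 ( *%R^~ (ln 2))); rewrite !mulfVK ?gt_eqF ?ln2_gt0//.
by move/ln_inj; apply.
Qed.

Lemma log2M (x y : R) : 0 < x -> 0 < y -> log2 (x * y) = log2 x + log2 y.
Proof. by move=> x0 y0; rewrite /log2 lnM ?posrE// mulrDl. Qed.

Lemma log2_ge0 (x : R) : 1 <= x -> 0 <= log2 x.
Proof. by move=> x1; rewrite divr_ge0 ?(ltW ln2_gt0)// ln_ge0. Qed.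


(** The derivative of [2^-1 * log2 x] at [x = 1]; its slope at [x] is [rate_slope / x]. *)
Definition rate_slope : R := 2^-1 / ln 2.

Lemma rate_slope_gt0 : 0 < rate_slope.
Proof. by rewrite divr_gt0 ?ln2_gt0// invr_gt0. Qed.

Lemma log2_tangent_le (x y : R) : 0 < x -> 0 < y ->
  2^-1 * log2 y <= 2^-1 * log2 x + rate_slope * ((y - x) / x).
Proof.
move=> x0 y0; have := ler_wpM2l (ltW rate_slope_gt0) (ln_tangent_le x0 y0).
rewrite mulrDr /rate_slope /log2; set u := (y - x) / x.
by rewrite !mulrA ![_ / ln 2 * _]mulrAC.
Qed.

Lemma log2_tangent_eq (x y : R) : 0 < x -> 0 < y ->
  2^-1 * log2 y = 2^-1 * log2 x + rate_slope * ((y - x) / x) -> y = x.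
Proof.
move=> x0 y0 e; apply: ln_tangent_eq => //.
apply: (mulfI (lt0r_neq0 rate_slope_gt0)).
rewrite mulrDr; move: e; rewrite /rate_slope /log2; set u := (y - x) / x.
by rewrite !mulrA ![_ / ln 2 * _]mulrAC.
Qed.

(** As a function of the power, the rate has slope [rate_slope / (a + w)] at [w]. This is exactly
    [rate_slope / l] when [w > 0]; when [w = 0] it is at most that, since then [a >= l], and only
    increases [q - w >= 0] are possible. *)
Lemma waterfill_slope_le (l a q w : R) : 0 < l -> 0 < a -> 0 <= q ->
  w = Num.max (l - a) 0 ->
  [/\ 0 < 1 + q / a, 0 < 1 + w / a &
    rate_slope * (((1 + q / a) - (1 + w / a)) / (1 + w / a)) <=
    rate_slope / l * q - rate_slope / l * w].
Proof.
move=> l0 a0 q0 wE; have w0 : 0 <= w by rewrite wE le_max lexx orbT.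
split; [by rewrite ltr_pwDl// divr_ge0// ltW|
        by rewrite ltr_pwDl// divr_ge0// ltW|].
rewrite -mulrBr -[_ / l * _]mulrA ler_wpM2l ?(ltW rate_slope_gt0)//.
have -> : ((1 + q / a) - (1 + w / a)) / (1 + w / a) = (q - w) / (a + w).
  by field; rewrite ?gt_eqF//; lra.
rewrite mulrC wE; case: (leP (l - a) 0) => la.
  by rewrite subr0 addr0 ler_wpM2r// lef_pV2 ?posrE//; lra.
by rewrite (addrC a) subrK.
Qed.

(* [(l - a)+] maximises [q |-> rate(1 + q / a) - rate_slope * q / l]. *)
Lemma waterfill_tangent_le (l a q w : R) : 0 < l -> 0 < a -> 0 <= q ->
  w = Num.max (l - a) 0 ->
  2^-1 * log2 (1 + q / a) + rate_slope / l * w <=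
  2^-1 * log2 (1 + w / a) + rate_slope / l * q.
Proof.
move=> l0 a0 q0 wE; have [y0 x0 s] := waterfill_slope_le l0 a0 q0 wE.
by have := log2_tangent_le x0 y0; lra.
Qed.

Lemma waterfill_tangent_eq (l a q w : R) : 0 < l -> 0 < a -> 0 <= q ->
  w = Num.max (l - a) 0 ->
  2^-1 * log2 (1 + q / a) + rate_slope / l * w =
  2^-1 * log2 (1 + w / a) + rate_slope / l * q -> q = w.
Proof.
move=> l0 a0 q0 wE e; have [y0 x0 s] := waterfill_slope_le l0 a0 q0 wE.
have : 1 + q / a = 1 + w / a.
  by apply: log2_tangent_eq => //; have := log2_tangent_le x0 y0; lra.
by move=> /addrI /(congr1 ( *%R^~ a)); rewrite !mulfVK ?gt_eqF.
Qed.

End real_inequalities.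

(** * Two users water-filling against each other *)

Section joint_waterfilling.
Context {R : realType}.

(** Complementary slackness for one user: the marginal value [g / (n + p * g)] equals [1 / l] at an
    active power and is at most [1 / l] at a zero power, where [q - p] is nonnegative. *)
Lemma waterfill_price_le (l g p q n : R) : 0 < l -> 0 < g -> 0 <= q -> 0 < n ->
  p = Num.max (l - n / g) 0 ->
  (q - p) * g / (n + p * g) <= (q - p) / l.
Proof.
move=> l0 g0 q0 n0; case: (leP (l - n / g) 0) => h ->.
  rewrite mul0r addr0 subr0 -mulrA ler_wpM2l//.
  rewrite ler_pdivrMr// mulrC ler_pdivlMr// mulrC.
  by move: h; rewrite subr_le0 ler_pdivlMr.
have -> : n + (l - n / g) * g = l * g by field; rewrite gt_eqF.
by rewrite -mulf_div divff ?mulr1// gt_eqF.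
Qed.

(** The tangent increment of the logarithm at the total received power splits into one term per
    user. Each term has the total level as denominator, which is also the level this user reaches
    above noise plus interference, so [waterfill_price_le] bounds both. *)
Lemma joint_waterfill_tangent (l1 l2 g1 g2 p1 p2 q1 q2 n : R) :
  0 < l1 -> 0 < l2 -> 0 < g1 -> 0 < g2 -> 0 < n ->
  0 <= q1 -> 0 <= q2 ->
  p1 = Num.max (l1 - (n + p2 * g2) / g1) 0 ->
  p2 = Num.max (l2 - (n + p1 * g1) / g2) 0 ->
  2^-1 * log2 (1 + (q1 * g1 + q2 * g2) / n) +
    (rate_slope / l1 * p1 + rate_slope / l2 * p2) <=
  2^-1 * log2 (1 + (p1 * g1 + p2 * g2) / n) +
    (rate_slope / l1 * q1 + rate_slope / l2 * q2).
Proof.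
move=> l10 l20 g10 g20 n0 q10 q20 e1 e2.
have p10 : 0 <= p1 by rewrite e1 le_max lexx orbT.
have p20 : 0 <= p2 by rewrite e2 le_max lexx orbT.
have i1 : 0 <= p1 * g1 by rewrite mulr_ge0// ltW.
have i2 : 0 <= p2 * g2 by rewrite mulr_ge0// ltW.
have j1 : 0 <= q1 * g1 by rewrite mulr_ge0// ltW.
have j2 : 0 <= q2 * g2 by rewrite mulr_ge0// ltW.
have x0 : 0 < 1 + (p1 * g1 + p2 * g2) / n.
  by rewrite ltr_pwDl// divr_ge0 ?addr_ge0// ltW.
have y0 : 0 < 1 + (q1 * g1 + q2 * g2) / n.
  by rewrite ltr_pwDl// divr_ge0 ?addr_ge0// ltW.
have n1 : 0 < n + p1 * g1 by rewrite ltr_pwDl.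
have n2 : 0 < n + p2 * g2 by rewrite ltr_pwDl.
have M0 : n + p1 * g1 + p2 * g2 != 0 by rewrite gt_eqF// ltr_pwDl.
have := log2_tangent_le x0 y0.
have -> : ((1 + (q1 * g1 + q2 * g2) / n) - (1 + (p1 * g1 + p2 * g2) / n)) /
          (1 + (p1 * g1 + p2 * g2) / n) =
    (q1 - p1) * g1 / (n + p2 * g2 + p1 * g1) +
    (q2 - p2) * g2 / (n + p1 * g1 + p2 * g2).
  rewrite (addrAC n (p2 * g2)).
  by field; rewrite ?M0 ?(gt_eqF n0)//= addrA M0.
have /(ler_wpM2l (ltW (@rate_slope_gt0 R))) :=
  lerD (waterfill_price_le l10 g10 q10 n2 e1)
       (waterfill_price_le l20 g20 q20 n1 e2).
rewrite [X in _ <= X -> _]mulrDr !(mulrC _^-1) ![rate_slope * ((_ - _) / _)]mulrA.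
rewrite !(mulrAC rate_slope (_ - _)) !mulrBr.
by lra.
Qed.

Lemma waterfill_active (l g p n : R) : 0 < g -> p = Num.max (l - n / g) 0 ->
  p != 0 -> n + p * g = l * g.
Proof.
move=> g0; case: (leP (l - n / g) 0) => _ -> => [/eqP//|_].
by field; rewrite gt_eqF.
Qed.

End joint_waterfilling.

(** * First-order gain of a small transfer of power *)

Section power_transfer.
Context {R : realType}.

(** The tangent is taken at the new power [q], so that it bounds the gain of the move from [p] to
    [q] from below. *)
Lemma log2_shift_le (g p q w n : R) : 0 < g -> 0 <= p -> 0 <= q -> 0 <= w ->
  0 < n ->
  2^-1 * log2 (1 + (p * g + w) / n) <=
  2^-1 * log2 (1 + (q * g + w) / n) +
    rate_slope * ((p - q) * g / (n + q * g + w)).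
Proof.
move=> g0 p0 q0 w0 n0.
have ip : 0 <= p * g by rewrite mulr_ge0// ltW.
have iq : 0 <= q * g by rewrite mulr_ge0// ltW.
have y0 : 0 < 1 + (p * g + w) / n by rewrite ltr_pwDl// divr_ge0 ?addr_ge0// ltW.
have x0 : 0 < 1 + (q * g + w) / n by rewrite ltr_pwDl// divr_ge0 ?addr_ge0// ltW.
have M0 : n + q * g + w != 0 by rewrite gt_eqF// ltr_wpDr// ltr_wpDr.
have <- : ((1 + (p * g + w) / n) - (1 + (q * g + w) / n)) /
          (1 + (q * g + w) / n) = (p - q) * g / (n + q * g + w).
  by field; rewrite ?M0 ?(gt_eqF n0)//= addrA M0.
exact: log2_tangent_le.
Qed.

(** The contribution of one state to [mu1 * R1 + mu2 * R2] when user 2 is decoded first, with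
    [c = mu1 - mu2], [k = mu2], [q] the power of user 1 and [w] the received power of user 2. *)
Definition weighted_rate (c k n g w q : R) :=
  c * (2^-1 * log2 (1 + q * g / n)) + k * (2^-1 * log2 (1 + (q * g + w) / n)).

(* The gain of moving the power by [e], of either sign, at a state where
   both users are active, i.e. where the water levels [l1] and [l2] are
   attained. *)
Lemma weighted_rate_shift (c k l1 l2 g1 g2 p w n e u : R) :
  0 <= c -> 0 <= k -> 0 < g1 -> 0 < n -> 0 <= p -> 0 <= p + e -> 0 <= w ->
  n + p * g1 = l1 * g1 -> n + p * g1 + w = l2 * g2 ->
  0 < u + e -> e * (l2 * g2) <= e * (u * g1) ->
  weighted_rate c k n g1 w p + rate_slope * e * (c / (l1 + e) + k / (u + e)) <=
  weighted_rate c k n g1 w (p + e).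
Proof.
move=> c0 k0 g0 n0 p0 q0 w0 h1 h2 ue0 eu.
have h1e : n + (p + e) * g1 = (l1 + e) * g1 by rewrite mulrDl addrA h1 mulrDl.
have l1e0 : 0 < l1 + e.
  by rewrite -(pmulr_lgt0 _ g0) -h1e ltr_wpDr// mulr_ge0// ltW.
have h2e : n + (p + e) * g1 + w = l2 * g2 + e * g1.
  by rewrite -h2 mulrDl; ring.
have M0 : 0 < l2 * g2 + e * g1.
  by rewrite -h2e ltr_wpDr// ltr_wpDr// mulr_ge0// ltW.
have /= t1 := log2_shift_le g0 p0 q0 (lexx 0) n0.
have {}t1 : 2^-1 * log2 (1 + p * g1 / n) + rate_slope * (e / (l1 + e)) <=
            2^-1 * log2 (1 + (p + e) * g1 / n).
  move: t1; rewrite !addr0 h1e opprD addrA subrr sub0r.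
  by rewrite -mulf_div divff ?mulr1 ?gt_eqF// mulNr mulrN lerBrDr.
(* The bound [u] lies above [l2 * g2 / g1] if [e > 0] and below it if [e < 0]; multiplying the
   hypothesis by [e] covers both signs at once. *)
have slope : e / (u + e) <= e * g1 / (l2 * g2 + e * g1).
  rewrite ler_pdivrMr// mulrAC ler_pdivlMr//.
  have -> : e * g1 * (u + e) = e * (u * g1) + e * (e * g1) by ring.
  by rewrite mulrDr lerD2r.
have t2 : 2^-1 * log2 (1 + (p * g1 + w) / n) + rate_slope * (e / (u + e)) <=
          2^-1 * log2 (1 + ((p + e) * g1 + w) / n).
  have := log2_shift_le g0 p0 q0 w0 n0.
  rewrite h2e opprD addrA subrr sub0r !mulNr mulrN lerBrDr; apply: le_trans.
  by rewrite lerD2l ler_wpM2l// ltW// rate_slope_gt0.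
rewrite /weighted_rate.
have -> : rate_slope * e * (c / (l1 + e) + k / (u + e)) =
  c * (rate_slope * (e / (l1 + e))) + k * (rate_slope * (e / (u + e))) by ring.
by have := ler_wpM2l c0 t1; have := ler_wpM2l k0 t2; rewrite !mulrDr; lra.
Qed.

(** At [x = y = 0] the last inequality is [k / v < k / u], hence strict, and continuity keeps it for
    a small [e]. Monotonicity in [x] and [y] then makes it uniform below [e], which allows steps of
    different sizes on the two sides of a transfer. *)
Lemma exists_small_step (c k l u v a : R) : 0 <= c -> 0 < k -> 0 < l ->
  0 < u -> u < v -> 0 < a ->
  exists2 e, 0 < e & forall x y, 0 < x <= e -> 0 < y <= e ->
    [/\ y < a, y < l, y < v & c / (l - y) + k / (v - y) < c / (l + x) + k / (u
      + x)].
Proof.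
move=> c0 k0 l0 u0 uv a0; have v0 := lt_trans u0 uv.
have gap0 : 0 < k / u - k / v by rewrite subr_gt0 ltr_pM2l// ltf_pV2.
have ccv z b : 0 < z -> b / (z - e) @[e --> (0 : R)] --> b / z.
  move=> z0; apply: cvgM; first exact: cvg_cst.
  apply: cvgV; first by rewrite gt_eqF.
  by rewrite -[X in _ --> X]subr0; apply: cvgB; [exact: cvg_cst|exact: cvg_id].
have ccv' z b : 0 < z -> b / (z + e) @[e --> (0 : R)] --> b / z.
  move=> z0; apply: cvgM; first exact: cvg_cst.
  apply: cvgV; first by rewrite gt_eqF.
  by rewrite -[X in _ --> X]addr0; apply: cvgD; [exact: cvg_cst|exact: cvg_id].
have h : c / (l + e) + k / (u + e) - (c / (l - e) + k / (v - e)) @[e --> (0 : R)]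
           --> c / l + k / u - (c / l + k / v).
  by apply: cvgB; apply: cvgD; (exact: ccv || exact: ccv').
have hpos : 0 < c / l + k / u - (c / l + k / v) by lra.
have near0 : \forall e \near (0:R)^'+, [/\ 0 < e, e < a, e < l, e < v &
    0 < c / (l + e) + k / (u + e) - (c / (l - e) + k / (v - e))].
  near=> e; split.
  - by near: e; exact: nbhs_right_gt.
  - by near: e; exact: nbhs_right_lt.
  - by near: e; exact: nbhs_right_lt.
  - by near: e; exact: nbhs_right_lt.
  - by near: e; exact: cvgr_gt (cvg_at_right_filter h) _ hpos.
near (0:R)^'+ => e.
have [e0 ea el ev he] : [/\ 0 < e, e < a, e < l, e < v &
    0 < c / (l + e) + k / (u + e) - (c / (l - e) + k / (v - e))].
  by near: e.
exists e => // x y /andP[x0 xe] /andP[y0 ye].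
split; [exact: le_lt_trans ye _|exact: le_lt_trans ye _|exact: le_lt_trans ye _|].
have inv_le (z w : R) : 0 < w -> w <= z -> z^-1 <= w^-1.
  by move=> w0 wz; rewrite lef_pV2 ?posrE// (lt_le_trans w0).
have a1 : c / (l + e) <= c / (l + x).
  by rewrite ler_wpM2l// inv_le ?addr_gt0 ?lerD2l.
have a2 : k / (u + e) <= k / (u + x).
  by rewrite ler_wpM2l ?(ltW k0)// inv_le ?addr_gt0 ?lerD2l.
have a3 : c / (l - y) <= c / (l - e).
  by rewrite ler_wpM2l// inv_le ?subr_gt0// lerD2l lerN2.
have a4 : k / (v - y) <= k / (v - e).
  by rewrite ler_wpM2l ?(ltW k0)// inv_le ?subr_gt0// lerD2l lerN2.
apply: (le_lt_trans (lerD a3 a4)); apply: (lt_le_trans _ (lerD a1 a2)).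
by rewrite -subr_gt0.
Unshelve. all: by end_near. Qed.

End power_transfer.

(** * Finiteness of extended-real rates *)

Section extended_reals.
Context {R : realType}.
Implicit Types x y : \bar R.

Lemma adde_fin_inj (k : R) x y : (x + k%:E = y + k%:E)%E -> x = y.
Proof. by move=> /(congr1 (fun z => z - k%:E)%E); rewrite !addeK. Qed.

(** The capacity region consists of real pairs, so a rate that could be infinite is bounded through
    the real numbers below it. *)
Lemma le_fin_of_minorants (m : R) x :
  (forall q : R, (q%:E <= x)%E -> q <= m) -> (x <= m%:E)%E.
Proof.
case: x => [r|h|_]; last exact: leNye.
  by move=> /(_ r (lexx _)); rewrite lee_fin.
by have := h (m + 1)%R (leey _); rewrite gerDl ler10.
Qed.

Lemma ge0_le_fin (m : R) x : (0 <= x)%E -> (x <= m%:E)%E ->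
  exists r : R, x = r%:E.
Proof.
by move=> x0 xm; exists (fine x);
  rewrite fineK// ge0_fin_numE// (le_lt_trans xm)// ltry.
Qed.

Lemma ge0_adde_eq_fin (r : R) x y : (0 <= x)%E -> (0 <= y)%E ->
  (x + y = r%:E)%E -> exists a b : R, [/\ x = a%:E, y = b%:E & a + b = r].
Proof.
move=> x0 y0 xy.
have [a xa] : exists a : R, x = a%:E by apply: (@ge0_le_fin r) => //;
  rewrite -xy leeDl.
have [b yb] : exists b : R, y = b%:E by apply: (@ge0_le_fin r) => //;
  rewrite -xy leeDr.
by exists a, b; split => //; move: xy; rewrite xa yb => -[].
Qed.

End extended_reals.

(** * Expectation under a density *)

Section weighted_expectation.
Context d (T : measurableType d) (R : realType).
Variables (mu : {measure set T -> \bar R}) (D : set T) (f : T -> R).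

Definition expect (g : T -> R) : \bar R := (\int[mu]_(x in D) (g x * f x)%:E)%E.

(** Almost sure truth under the law of density [f] on [D]: states of zero density are
    disregarded. *)
Definition ae_dens (P : T -> Prop) :=
  {ae mu, forall x, D x -> 0 < f x -> P x}.

Definition mnonneg (g : T -> R) :=
  measurable_fun D g /\ forall x, D x -> 0 <= g x.

Lemma ae_densW (P : T -> Prop) : (forall x, D x -> P x) -> ae_dens P.
Proof. by move=> DP; apply: aeW => x Dx _; exact: DP. Qed.

Lemma ae_densS (P Q : T -> Prop) :
  (forall x, D x -> P x -> Q x) -> ae_dens P -> ae_dens Q.
Proof. by move=> PQ; rewrite /ae_dens;
  apply: filterS => x + Dx fx => /(_ Dx fx); exact: PQ. Qed.

Lemma ae_densS2 (P Q S : T -> Prop) :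
  (forall x, D x -> P x -> Q x -> S x) ->
  ae_dens P -> ae_dens Q -> ae_dens S.
Proof.
move=> PQS; rewrite /ae_dens; apply: filterS2 => x + + Dx fx.
by move=> /(_ Dx fx) Px /(_ Dx fx) Qx; exact: PQS.
Qed.

Lemma ae_densS3 (P Q S U : T -> Prop) :
  (forall x, D x -> P x -> Q x -> S x -> U x) ->
  ae_dens P -> ae_dens Q -> ae_dens S -> ae_dens U.
Proof.
move=> PQSU; rewrite /ae_dens; apply: filterS3 => x + + + Dx fx.
by move=> /(_ Dx fx) Px /(_ Dx fx) Qx /(_ Dx fx) Sx; exact: PQSU.
Qed.

Lemma measurable_funV_gt0 (g : T -> R) : (forall x, D x -> 0 < g x) ->
  measurable_fun D g -> measurable_fun D (fun x => (g x)^-1).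
Proof.
move=> g0 mg; apply: (eq_measurable_fun (fun x => expR (- ln (g x)))).
  by move=> x /[!inE] Dx; rewrite expRN lnK ?posrE ?g0.
apply: (measurableT_comp (@measurable_expR R)).
by apply: measurable_funN; exact: measurableT_comp (@measurable_ln R) mg.
Qed.

Lemma measurable_log2 (g : T -> R) :
  measurable_fun D g -> measurable_fun D (fun x => log2 (g x)).
Proof.
move=> mg; apply: measurable_funM; last exact: measurable_cst.
exact: measurableT_comp (@measurable_ln R) mg.
Qed.

Lemma mnonneg_cst (k : R) : 0 <= k -> mnonneg (cst k).
Proof. by move=> k0; split => //; exact: measurable_cst. Qed.

Lemma mnonnegD (g h : T -> R) : mnonneg g -> mnonneg h ->
  mnonneg (fun x => g x + h x).
Proof.
move=> [mg g0] [mh h0]; split; first exact: measurable_funD.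
by move=> x Dx; rewrite addr_ge0 ?g0 ?h0.
Qed.

Lemma mnonnegM (g h : T -> R) : mnonneg g -> mnonneg h ->
  mnonneg (fun x => g x * h x).
Proof.
move=> [mg g0] [mh h0]; split; first exact: measurable_funM.
by move=> x Dx; rewrite mulr_ge0 ?g0 ?h0.
Qed.

Lemma mnonnegZ (k : R) (g : T -> R) : 0 <= k -> mnonneg g ->
  mnonneg (fun x => k * g x).
Proof. by move=> k0; apply: mnonnegM; exact: mnonneg_cst. Qed.

Lemma mnonneg_indic (A : set T) : measurable A -> mnonneg (\1_A).
Proof. by move=> mA; split => //; exact: measurable_indic. Qed.

Hypotheses (mD : measurable D) (f_ge0 : forall x, D x -> 0 <= f x)
  (mf : measurable_fun D f) (f_int1 : (\int[mu]_(x in D) (f x)%:E = 1)%E).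

Lemma expect_measurable (g : T -> R) : measurable_fun D g ->
  measurable_fun D (fun x => (g x * f x)%:E).
Proof. by move=> mg; apply/measurable_EFinP; exact: measurable_funM. Qed.

Lemma expect_integrand_ge0 g x : mnonneg g -> D x -> (0 <= (g x * f x)%:E)%E.
Proof. by move=> [_ g0] Dx; rewrite lee_fin mulr_ge0 ?g0 ?f_ge0. Qed.

Lemma expect_ge0 g : mnonneg g -> (0 <= expect g)%E.
Proof. by move=> g0; apply: integral_ge0 => x; exact: expect_integrand_ge0. Qed.

Lemma expect_le g h : mnonneg g -> mnonneg h ->
  ae_dens (fun x => g x <= h x) -> (expect g <= expect h)%E.
Proof.
move=> g0 h0 gh; apply: ae_ge0_le_integral => //.
- by move=> x; exact: expect_integrand_ge0.
- by apply: expect_measurable; case: g0.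
- by move=> x; exact: expect_integrand_ge0.
- by apply: expect_measurable; case: h0.
move: gh; rewrite /ae_dens; apply: filterS => x /= gh Dx.
have := f_ge0 Dx; rewrite le_eqVlt => /predU1P[<-|fx].
  by rewrite !mulr0.
by rewrite lee_fin ler_pM2r// gh.
Qed.

Lemma expect_eq g h : mnonneg g -> mnonneg h ->
  ae_dens (fun x => g x = h x) -> expect g = expect h.
Proof.
move=> g0 h0 gh; apply/eqP; rewrite eq_le; apply/andP; split.
  by apply: expect_le => //; apply: ae_densS gh => x _ ->.
by apply: expect_le => //; apply: ae_densS gh => x _ ->.
Qed.

Lemma expectD g h : mnonneg g -> mnonneg h ->
  expect (fun x => g x + h x) = (expect g + expect h)%E.
Proof.
move=> g0 h0; rewrite /expect -ge0_integralD//.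
- by apply: eq_integral => x _; rewrite mulrDl EFinD.
- by move=> x; exact: expect_integrand_ge0.
- by apply: expect_measurable; case: g0.
- by move=> x; exact: expect_integrand_ge0.
- by apply: expect_measurable; case: h0.
Qed.

Lemma expectZ k g : 0 <= k -> mnonneg g ->
  expect (fun x => k * g x) = (k%:E * expect g)%E.
Proof.
move=> k0 g0; rewrite /expect -ge0_integralZl_EFin//.
- by apply: eq_integral => x _; rewrite -EFinM mulrA.
- by move=> x; exact: expect_integrand_ge0.
- by apply: expect_measurable; case: g0.
Qed.

Lemma expect_cst k : 0 <= k -> expect (cst k) = k%:E.
Proof.
move=> k0.
have := @expectZ k (cst 1) k0 (mnonneg_cst ler01).
rewrite (_ : expect (cst 1) = 1%E) ?mule1 => [<-|].
  by congr expect; apply/funext => x /=; rewrite mulr1.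
by rewrite -f_int1; apply: eq_integral => x _ /=; rewrite mul1r.
Qed.

Lemma expect_fin g h : mnonneg g -> mnonneg h ->
  ae_dens (fun x => g x <= h x) -> (expect h < +oo)%E -> expect g \is a fin_num.
Proof.
by move=> g0 h0 gh hoo;
  rewrite ge0_fin_numE ?expect_ge0// (le_lt_trans _ hoo)// expect_le.
Qed.

Lemma expect_eq0 g : mnonneg g -> expect g = 0%E -> ae_dens (fun x => g x = 0).
Proof.
move=> g0 Eg; have [mg _] := g0.
have /(ae_eq_integral_abs mu mD (expect_measurable mg)) :
    (\int[mu]_(x in D) `|(g x * f x)%:E| = 0)%E.
  rewrite -Eg; apply: eq_integral => x /[!inE] Dx.
  by rewrite gee0_abs// expect_integrand_ge0.
rewrite /ae_dens; apply: filterS => x /= H Dx fx; have /eqP := H Dx.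
by rewrite eqe mulf_eq0 (gt_eqF fx) orbF => /eqP.
Qed.

(** Almost everywhere [h] is [g] plus the positive part [u] of [h - g]. Since [expect g] is finite
    it cancels, and [u] has zero expectation. *)
Lemma expect_strict g h : mnonneg g -> mnonneg h ->
  ae_dens (fun x => g x <= h x) -> (expect h <= expect g)%E ->
  (expect g < +oo)%E -> ae_dens (fun x => g x = h x).
Proof.
move=> g0 h0 gh hg goo.
pose u x := Num.max (h x - g x) 0.
have u0 : mnonneg u.
  split; last by move=> x _; rewrite le_max lexx orbT.
  apply: measurable_maxr; last exact: measurable_cst.
  by apply: measurable_funB; [case: h0|case: g0].
have ghu : ae_dens (fun x => h x = g x + u x).
  by apply: ae_densS gh => x _ gh; rewrite /u max_l ?subr_ge0//; lra.
have gfin : expect g \is a fin_num by rewrite ge0_fin_numE ?expect_ge0.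
have /(expect_eq0 u0) : expect u = 0%E.
  apply/eqP; rewrite eq_le expect_ge0// andbT -(leeD2lE _ _ gfin) adde0.
  by rewrite -expectD// -(expect_eq h0 (mnonnegD g0 u0)).
by apply: ae_densS2 ghu => x _ -> ->; rewrite addr0.
Qed.

Lemma expect_indic_eq0 (A : set T) : measurable A ->
  expect (\1_A) = 0%E <-> ae_dens (fun x => ~ A x).
Proof.
move=> mA; split=> [/(expect_eq0 (mnonneg_indic mA))|nA].
  apply: ae_densS => x _ /= + Ax; rewrite indicE mem_set// => /eqP.
  by rewrite oner_eq0.
rewrite -[RHS](expect_cst (lexx 0)); apply: expect_eq; first exact: mnonneg_indic.
  exact: (mnonneg_cst (lexx 0)).
by apply: ae_densS nA => x _ nA; rewrite indicE memNset.
Qed.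

End weighted_expectation.

(** * Water-filling *)

Section waterfilling.
Context d (T : measurableType d) (R : realType).
Variables (mu : {measure set T -> \bar R}) (D : set T) (f : T -> R).

(** Here [a] is the noise-to-gain ratio of each state and [l] the water level. *)
Definition waterfill (l : R) (a : T -> R) (x : T) := Num.max (l - a x) 0.

Definition capacity (P a : T -> R) (x : T) := 2^-1 * log2 (1 + P x / a x).

Definition budget (Pb : R) (P : T -> R) :=
  mnonneg D P /\ (expect mu D f P <= Pb%:E)%E.

Definition best_response (Pb : R) (a P : T -> R) :=
  budget Pb P /\ forall Q, budget Pb Q ->
    (expect mu D f (capacity Q a) <= expect mu D f (capacity P a))%E.

Definition mpos (a : T -> R) := measurable_fun D a /\ forall x, D x -> 0 < a x.

Lemma mpos_mnonneg a : mpos a -> mnonneg D a.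
Proof. by move=> [ma a0]; split=> // x Dx; rewrite ltW ?a0. Qed.

Lemma mposD a g : mpos a -> mnonneg D g -> mpos (fun x => a x + g x).
Proof.
move=> [ma a0] [mg g0]; split; first exact: measurable_funD.
by move=> x Dx; rewrite ltr_pwDl ?a0 ?g0.
Qed.

Lemma mposV a : mpos a -> mpos (fun x => (a x)^-1).
Proof.
move=> [ma a0]; split; first exact: measurable_funV_gt0.
by move=> x Dx; rewrite invr_gt0 a0.
Qed.

Lemma mposM a b : mpos a -> mpos b -> mpos (fun x => a x * b x).
Proof.
move=> [ma a0] [mb b0]; split; first exact: measurable_funM.
by move=> x Dx; rewrite mulr_gt0 ?a0 ?b0.
Qed.

Lemma mpos_cst k : 0 < k -> mpos (cst k).
Proof. by move=> k0; split => //; exact: measurable_cst. Qed.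

Lemma capacity_mnonneg P a : mnonneg D P -> mpos a -> mnonneg D (capacity P a).
Proof.
move=> P0 a0; have V0 := mpos_mnonneg (mposV a0); split.
  apply: measurable_funM; first exact: measurable_cst.
  apply: measurable_log2; apply: measurable_funD; first exact: measurable_cst.
  by have [] := mnonnegM P0 V0.
move=> x Dx; have [_ /(_ x Dx) Px] := mnonnegM P0 V0.
by rewrite mulr_ge0 ?invr_ge0 ?ler0n// log2_ge0// lerDl.
Qed.

Lemma waterfill_mnonneg l a : mpos a -> mnonneg D (waterfill l a).
Proof.
move=> [ma _]; split; last by move=> x _; rewrite le_max lexx orbT.
apply: measurable_maxr; last exact: measurable_cst.
by apply: measurable_funB => //; exact: measurable_cst.
Qed.

Hypotheses (mD : measurable D) (f_ge0 : forall x, D x -> 0 <= f x)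
  (mf : measurable_fun D f) (f_int1 : (\int[mu]_(x in D) (f x)%:E = 1)%E).

Local Notation E := (expect mu D f).
Local Notation ae P := (ae_dens mu D f P).

(** Lagrangian duality with multiplier [k = rate_slope / l]: the pointwise tangent inequality is
    integrated, and the water-filling spends the whole budget while [Q] spends at most that. Equal
    values force pointwise equality, which identifies [Q]. *)
Lemma waterfill_optimal l a Pb Q : 0 < l -> mpos a ->
  E (waterfill l a) = Pb%:E -> budget Pb Q ->
  (E (capacity Q a) <= E (capacity (waterfill l a) a))%E /\
  ((E (capacity (waterfill l a) a) <= E (capacity Q a))%E ->
   (E (capacity Q a) < +oo)%E -> ae (fun x => Q x = waterfill l a x)).
Proof.
move=> l0 a0 EW [Q0 EQ]; have W0 := waterfill_mnonneg l a0.
have ax x : D x -> 0 < a x by case: a0 => _; exact.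
have Qx x : D x -> 0 <= Q x by case: Q0 => _; exact.
have tgle x Dx := waterfill_tangent_le l0 (ax x Dx) (Qx x Dx) erefl.
have tgeq x Dx := waterfill_tangent_eq l0 (ax x Dx) (Qx x Dx) erefl.
move: tgle tgeq; set k := rate_slope / l => tgle tgeq.
have k0 : 0 <= k by rewrite ltW// divr_gt0 ?rate_slope_gt0.
have kQ0 : mnonneg D (fun x => k * Q x) by exact: mnonnegZ.
have kW0 : mnonneg D (fun x => k * waterfill l a x) by exact: mnonnegZ.
have cQ0 := capacity_mnonneg Q0 a0; have cW0 := capacity_mnonneg W0 a0.
have EkW : E (fun x => k * waterfill l a x) = (k * Pb)%:E.
  by rewrite expectZ// EW.
have EkQ : (E (fun x => k * Q x)%R <= (k * Pb)%:E)%E.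
  by rewrite expectZ// [(k * Pb)%:E]EFinM lee_wpmul2l.
split=> [|WQ Qoo].
  (* The capacities may be infinite, so the power cost is added to both sides instead of being
     subtracted. *)
  rewrite -(@leeD2rE _ (k * Pb)%:E)//.
  apply: (@le_trans _ _ (E (capacity (waterfill l a) a) + E (fun x => k * Q
    x)%R)%E).
    rewrite -EkW -!expectD//; apply: expect_le => //; do ?exact: mnonnegD.
    exact: ae_densW.
  by rewrite leeD2l.
have : ae (fun x => capacity Q a x + k * waterfill l a x =
                    capacity (waterfill l a) a x + k * Q x).
  apply: expect_strict; rewrite ?expectD//; do ?exact: mnonnegD.
  - exact: ae_densW.
  - by apply: leeD => //; rewrite EkW.
  - by rewrite lte_add_pinfty// EkW ltry.
by apply: ae_densS => x Dx; exact: tgeq.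
Qed.

Lemma waterfill_level_gt0 l a Pb : 0 < Pb -> mpos a ->
  E (waterfill l a) = Pb%:E -> 0 < l.
Proof.
move=> Pb0 a0 EW; rewrite ltNge; apply/negP => l0.
have : E (waterfill l a) = E (cst 0).
  apply: expect_eq => //; first exact: waterfill_mnonneg.
  apply: ae_densW => x Dx; rewrite /waterfill max_r//.
  by have [_ /(_ x Dx)] := a0; lra.
by rewrite expect_cst// EW => -[] /eqP; rewrite gt_eqF.
Qed.

(** The water-filling of level [n], divided by [n], increases to 1 pointwise. By monotone
    convergence its mean is eventually above one half, so the mean power at level [n] exceeds
    [n / 2]. *)
Lemma waterfill_unbounded a Pb : mpos a ->
  exists2 l, 0 <= l & (Pb%:E <= E (waterfill l a))%E.
Proof.
move=> a0; apply: contrapT => noL.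
pose u n x := Num.max (1 - a x / n.+1%:R) 0.
have u0 n : mnonneg D (u n).
  split; last by move=> x _; rewrite le_max lexx orbT.
  apply: measurable_maxr; last exact: measurable_cst.
  apply: measurable_funB; first exact: measurable_cst.
  by apply: measurable_funM; [case: a0|exact: measurable_cst].
have ucvg x : D x -> (u n x * f x)%:E @[n --> \oo] --> (f x)%:E.
  move=> Dx; apply: cvg_EFin; first by near=> n.
  rewrite -[X in _ --> X]mul1r; apply: cvgM; last exact: cvg_cst.
  have ax : 0 < a x by case: a0 => _; exact.
  apply/cvgrPdist_le => e e0; near=> n.
  have an : a x / n.+1%:R <= e.
    rewrite ler_pdivrMr// mulrC -ler_pdivrMr//.
    by apply: (@le_trans _ _ n%:R); [near: n;
      exact: nbhs_infty_ger|rewrite ler_nat].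
  have an0 : 0 <= a x / n.+1%:R by rewrite divr_ge0// ltW.
  rewrite /u; move: an an0; set v := a x / _ => an an0.
  by case: (leP (1 - v) 0) => h; rewrite ger0_norm; lra.
have Eu : E (u n) @[n --> \oo] --> 1%E.
  have -> : 1%E = (\int[mu]_(x in D) limn (fun n => (u n x * f x)%:E))%E.
    rewrite -f_int1; apply: eq_integral => x /[!inE] Dx.
    by apply/esym/cvg_lim => //; exact: ucvg.
  apply: cvg_monotone_convergence => //.
  - by move=> n; apply: expect_measurable => //; case: (u0 n).
  - by move=> n x; exact: expect_integrand_ge0.
  move=> x Dx m n mn; rewrite lee_fin ler_wpM2r ?f_ge0//.
  rewrite /u ge_max !le_max lexx !orbT andbT lerB// ler_wpM2l//.
    by case: a0 => _ /(_ x Dx)/ltW.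
  by rewrite lef_pV2 ?posrE ?ltr0n// ler_nat.
have : (1 <= 2^-1%:E :> \bar R)%E.
  apply: (cvge_to_le Eu); near=> n.
  rewrite leNgt; apply/negP => un; apply: noL; exists n.+1%:R => //.
  have -> : E (waterfill n.+1%:R a) = (n.+1%:R%:E * E (u n))%E.
    rewrite -expectZ//; congr expect; apply/funext => x.
    have n0 : n.+1%:R != 0 :> R by rewrite pnatr_eq0.
    by rewrite /waterfill /u maxr_pMr// mulr0 mulrBr mulr1 mulrCA divff ?mulr1.
  have Pbn : Pb <= n.+1%:R * 2^-1.
    rewrite ler_pdivlMr//.
    by apply: (@le_trans _ _ n%:R); [near: n;
      exact: nbhs_infty_ger|rewrite ler_nat].
  apply: (@le_trans _ _ (n.+1%:R * 2^-1)%:E); first by rewrite lee_fin.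
  by rewrite EFinM lee_wpmul2l// ltW.
by rewrite lee_fin; lra.
Unshelve. all: by end_near. Qed.

(** The mean power is nondecreasing and 1-Lipschitz in the level, zero at level 0 and unbounded; the
    intermediate value theorem gives the level. *)
Lemma waterfill_level_exists a Pb : 0 < Pb -> mpos a ->
  exists l, E (waterfill l a) = Pb%:E.
Proof.
move=> Pb0 a0; have W0 l := waterfill_mnonneg l a0.
have Wfin l : E (waterfill l a) \is a fin_num.
  apply: (@expect_fin _ _ _ _ _ _ mD f_ge0 mf _ (cst (Num.max l 0))) => //.
  - by apply: mnonneg_cst; rewrite le_max lexx orbT.
  - apply: ae_densW => x Dx; rewrite /waterfill /= ge_max !le_max lexx !orbT andbT.
    by have [_ /(_ x Dx) ax] := a0; rewrite lerBlDr lerDl (ltW ax).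
  - by rewrite expect_cst ?ltry// le_max lexx orbT.
pose phi l := fine (E (waterfill l a)).
have phi_lip l l' : l <= l' -> phi l <= phi l' <= phi l + (l' - l).
  move=> ll'; have d0 : 0 <= l' - l by rewrite subr_ge0.
  rewrite -!lee_fin EFinD !fineK//; apply/andP; split.
    apply: expect_le => //; apply: ae_densW => x Dx.
    by rewrite /waterfill ge_max !le_max lerB// lexx orbT.
  have c0 := mnonneg_cst D d0.
  rewrite -(expect_cst mD f_ge0 mf f_int1 d0) -expectD//.
  apply: expect_le => //; first exact: mnonnegD.
  apply: ae_densW => x Dx; rewrite /waterfill /=.
  by case: (leP (l' - a x) 0); case: (leP (l - a x) 0); lra.
have phi_cont : continuous phi.
  move=> l; apply/cvgrPdist_le => e e0; near=> l'.
  have : `|l - l'| <= e by near: l'; exact: cvgr_dist_le.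
  apply: le_trans; case: (leP l l') => ll'.
    by rewrite !ler0_norm; have /andP[] := phi_lip _ _ ll'; lra.
  by rewrite !ger0_norm; have /andP[] := phi_lip _ _ (ltW ll'); lra.
have phi0 : phi 0 = 0.
  have W00 : E (waterfill 0 a) = E (cst 0).
    apply: expect_eq => //.
    apply: ae_densW => x Dx; rewrite /waterfill max_r//.
    by have [_ /(_ x Dx)] := a0; lra.
  by rewrite /phi W00 expect_cst.
have [L L0] := waterfill_unbounded Pb a0.
rewrite -[E _]fineK// lee_fin -/(phi L) => PbL.
have [|l _ <-] := @IVT _ phi 0 L Pb L0 (continuous_subspaceT phi_cont).
  by rewrite phi0 min_l ?max_r ?(ltW Pb0)//; case/andP: (phi_lip _ _ L0);
    rewrite phi0.
by exists l; rewrite fineK.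
Unshelve. all: by end_near. Qed.

(** The water-filling that meets the budget is a competitor of [P], so [P] attains its value; the
    equality case of [waterfill_optimal] applies because this value is finite. *)
Lemma best_responseP a Pb P : 0 < Pb -> mpos a -> best_response Pb a P ->
  (E (capacity P a) < +oo)%E ->
  exists2 l, 0 < l & E (waterfill l a) = Pb%:E /\
                     ae (fun x => P x = waterfill l a x).
Proof.
move=> Pb0 a0 [bP Pmax] Poo; have [l El] := waterfill_level_exists Pb0 a0.
have l0 := waterfill_level_gt0 Pb0 a0 El; exists l => //; split=> //.
have bW : budget Pb (waterfill l a).
  by split; [exact: waterfill_mnonneg|rewrite El].
by have [_] := waterfill_optimal l0 a0 El bP; apply => //; exact: Pmax.
Qed.

End waterfilling.

(** * Rates, equilibria and the sum rate *)

Section mac_rates.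
Context d (T : measurableType d) (R : realType).
Variables (mu : {measure set T -> \bar R}) (D : set T) (f : T -> R) (s2 : R).

(** The effective noise of a user who is decoded first on [A], where [g] and [P] belong to the other
    user. *)
Definition noise (A : set T) (g P : T -> R) (x : T) := s2 + P x * g x * \1_A x.

Definition nrate (N g P : T -> R) : \bar R :=
  expect mu D f (fun x => 2^-1 * log2 (1 + P x * g x / N x)).

Definition sum_rate (g1 g2 P1 P2 : T -> R) : \bar R :=
  expect mu D f (fun x => 2^-1 * log2 (1 + (P1 x * g1 x + P2 x * g2 x) / s2)).

Definition nash (Pb1 Pb2 : R) (g1 g2 : T -> R) (A : set T) (P1 P2 : T -> R) :=
  best_response mu D f Pb1 (fun x => noise A g2 P2 x / g1 x) P1 /\
  best_response mu D f Pb2 (fun x => noise (~` A) g1 P1 x / g2 x) P2.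

Lemma rate_capacity (N g P : T -> R) :
  (fun x => 2^-1 * log2 (1 + P x * g x / N x)) =
  capacity P (fun x => N x / g x).
Proof.
by apply/funext => x; rewrite /capacity invf_div [P x * (_ / _)]mulrA.
Qed.

Lemma nrateE N g P :
  nrate N g P = expect mu D f (capacity P (fun x => N x / g x)).
Proof. by rewrite /nrate rate_capacity. Qed.

Hypothesis s2_gt0 : 0 < s2.

Lemma noise_mpos A g P : measurable A -> mpos D g -> mnonneg D P ->
  mpos D (noise A g P).
Proof.
move=> mA /mpos_mnonneg g0 P0; apply: mposD; first exact: mpos_cst.
exact: mnonnegM (mnonnegM P0 g0) (mnonneg_indic _ _ mA).
Qed.

Lemma mpos_div (N g : T -> R) : mpos D N -> mpos D g ->
  mpos D (fun x => N x / g x).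
Proof. by move=> N0 g0; apply: mposM => //; exact: mposV. Qed.

Lemma nrate_mnonneg (N g P : T -> R) : mpos D N -> mpos D g -> mnonneg D P ->
  mnonneg D (fun x => 2^-1 * log2 (1 + P x * g x / N x)).
Proof.
by move=> N0 g0 P0; rewrite rate_capacity; exact/capacity_mnonneg/mpos_div.
Qed.

Lemma sum_rate_mnonneg (g1 g2 P1 P2 : T -> R) : mpos D g1 -> mpos D g2 ->
  mnonneg D P1 -> mnonneg D P2 ->
  mnonneg D (fun x => 2^-1 * log2 (1 + (P1 x * g1 x + P2 x * g2 x) / s2)).
Proof.
move=> g10 g20 P10 P20; have := @capacity_mnonneg _ _ _ D
  (fun x => P1 x * g1 x + P2 x * g2 x) (cst s2) _ (mpos_cst D s2_gt0).
by apply; apply: mnonnegD; apply: mnonnegM => //; exact: mpos_mnonneg.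
Qed.

Hypotheses (mD : measurable D) (f_ge0 : forall x, D x -> 0 <= f x)
  (mf : measurable_fun D f) (f_int1 : (\int[mu]_(x in D) (f x)%:E = 1)%E).

Local Notation E := (expect mu D f).
Local Notation ae P := (ae_dens mu D f P).

Lemma nrate_ge0 N g P : mpos D N -> mpos D g -> mnonneg D P ->
  (0 <= nrate N g P)%E.
Proof. by move=> N0 g0 P0; apply: expect_ge0 => //; exact: nrate_mnonneg. Qed.

Lemma nrate_eq N N' g P P' : mpos D N -> mpos D N' -> mpos D g ->
  mnonneg D P -> mnonneg D P' ->
  ae (fun x => N x = N' x) -> ae (fun x => P x = P' x) ->
  nrate N g P = nrate N' g P'.
Proof.
move=> N0 N'0 g0 P0 P'0 NN' PP'; apply: expect_eq => //.
- exact: nrate_mnonneg.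
- exact: nrate_mnonneg.
by apply: ae_densS2 NN' PP' => x _ -> ->.
Qed.

Lemma nrate_noise_le A g g' P P' : measurable A -> mpos D g -> mpos D g' ->
  mnonneg D P -> mnonneg D P' ->
  (nrate (noise A g' P') g P <= nrate (cst s2) g P)%E.
Proof.
move=> mA g0 g'0 P0 P'0; have N0 := noise_mpos mA g'0 P'0.
have c0 := mpos_cst D s2_gt0.
apply: expect_le => //; do ?exact: nrate_mnonneg.
apply: ae_densW => x Dx.
have [_ /(_ x Dx) Nx] := N0.
have [_ /(_ x Dx) Px] := mnonnegM P0 (mpos_mnonneg g0).
have [_ /(_ x Dx) Ix] := mnonnegM P'0 (mpos_mnonneg g'0).
rewrite ler_wpM2l ?invr_ge0// log2_le//.
  by rewrite ltr_pwDl// divr_ge0// ltW.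
rewrite lerD2l ler_wpM2l// lef_pV2 ?posrE//= /noise lerDl mulr_ge0//.
Qed.

(** If removing the interference does not raise a finite rate, the two integrands agree almost
    surely. By injectivity of the logarithm, on [A] there is then either no signal or no
    interference. *)
Lemma nrate_noise_eq A g g' P P' : measurable A -> mpos D g -> mpos D g' ->
  mnonneg D P -> mnonneg D P' ->
  (nrate (cst s2) g P <= nrate (noise A g' P') g P)%E ->
  (nrate (noise A g' P') g P < +oo)%E ->
  ae (fun x => A x -> P x = 0 \/ P' x = 0).
Proof.
move=> mA g0 g'0 P0 P'0 le_rate fin_rate; have N0 := noise_mpos mA g'0 P'0.
have c0 := mpos_cst D s2_gt0.
have Ix x Dx := (mnonnegM P'0 (mpos_mnonneg g'0)).2 x Dx.
have Px x Dx := (mnonnegM P0 (mpos_mnonneg g0)).2 x Dx.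
have Nx x Dx := N0.2 x Dx.
have le_arg x : D x -> 1 + P x * g x / noise A g' P' x <= 1 + P x * g x / s2.
  move=> Dx; rewrite lerD2l ler_wpM2l// ?Px// lef_pV2 ?posrE ?Nx//.
  by rewrite /noise lerDl mulr_ge0// Ix.
have arg0 x : D x -> 0 < 1 + P x * g x / noise A g' P' x.
  by move=> Dx; rewrite ltr_pwDl// divr_ge0// ?Px// ltW// Nx.
have : ae (fun x => 2^-1 * log2 (1 + P x * g x / noise A g' P' x) =
                    2^-1 * log2 (1 + P x * g x / cst s2 x)).
  apply: expect_strict => //; do ?exact: nrate_mnonneg.
  apply: ae_densW => x Dx; rewrite ler_wpM2l ?invr_ge0// log2_le//.
    exact: arg0.
  exact: le_arg.
apply: ae_densS => x Dx /mulfI; rewrite invr_eq0 pnatr_eq0 => /(_ isT).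
move/log2_inj => /(_ (arg0 x Dx) (lt_le_trans (arg0 x Dx) (le_arg x Dx))).
move/addrI => e Ax; have [->|P'x] := eqVneq (P' x) 0; [by right|left].
have [_ /(_ x Dx) gx] := g0; have [_ /(_ x Dx) g'x] := g'0.
move: e; have [//|Pn0] := eqVneq (P x) 0.
have PG : P x * g x != 0 by rewrite mulf_neq0// gt_eqF.
move/(mulfI PG)/invr_inj/eqP; rewrite /noise /= indicE mem_set// mulr1.
by rewrite -subr_eq0 addrC addKr mulf_eq0 (negbTE P'x) gt_eqF.
Qed.

(** In each state the product of the two arguments of the logarithm telescopes to
    [1 + (u + v) / s2], with [u] and [v] the received powers, in either decoding order. *)
Lemma nrate_sum A g1 g2 P1 P2 : measurable A -> mpos D g1 -> mpos D g2 ->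
  mnonneg D P1 -> mnonneg D P2 ->
  (nrate (noise A g2 P2) g1 P1 + nrate (noise (~` A) g1 P1) g2 P2 =
   sum_rate g1 g2 P1 P2)%E.
Proof.
move=> mA g10 g20 P10 P20; have mAC := measurableC mA.
have N10 := noise_mpos mA g20 P20; have N20 := noise_mpos mAC g10 P10.
rewrite -expectD//; do ?exact: nrate_mnonneg.
apply: expect_eq => //.
- by apply: mnonnegD; exact: nrate_mnonneg.
- exact: sum_rate_mnonneg.
apply: ae_densW => x Dx; rewrite -mulrDr; congr (_ * _).
have I1 : 0 <= P1 x * g1 x := (mnonnegM P10 (mpos_mnonneg g10)).2 x Dx.
have I2 : 0 <= P2 x * g2 x := (mnonnegM P20 (mpos_mnonneg g20)).2 x Dx.
have N1x := N10.2 x Dx; have N2x := N20.2 x Dx.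
rewrite -log2M; last 2 first.
  by rewrite ltr_pwDl// divr_ge0// ltW.
  by rewrite ltr_pwDl// divr_ge0// ltW.
congr log2; rewrite /noise !indicE in_setC.
move: I1 I2; set u := P1 x * g1 x; set v := P2 x * g2 x => u0 v0.
have [s20 su sv] : [/\ s2 != 0, s2 + u != 0 & s2 + v != 0].
  by split; rewrite gt_eqF// ltr_wpDr.
by case: (x \in A); rewrite /= ?mulr1 ?mulr0 ?addr0; field; rewrite ?s20 ?su ?sv.
Qed.

Lemma noise_set0 g P : noise set0 g P = cst s2.
Proof. by apply/funext => x; rewrite /noise indic0 mulr0 addr0. Qed.

Lemma noise_setT g P : noise setT g P = fun x => s2 + P x * g x.
Proof. by apply/funext => x; rewrite /noise indicT mulr1. Qed.

Lemma nrate_sum_decode2 g1 g2 P1 P2 : mpos D g1 -> mpos D g2 ->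
  mnonneg D P1 -> mnonneg D P2 ->
  (nrate (cst s2) g1 P1 + nrate (fun x => s2 + P1 x * g1 x)%R g2 P2 =
   sum_rate g1 g2 P1 P2)%E.
Proof.
move=> g10 g20 P10 P20; have := nrate_sum measurable0 g10 g20 P10 P20.
by rewrite setC0 noise_set0 noise_setT.
Qed.

Lemma sum_rateC g1 g2 P1 P2 : sum_rate g1 g2 P1 P2 = sum_rate g2 g1 P2 P1.
Proof. by rewrite /sum_rate; congr expect; apply/funext => x;
  rewrite [P1 x * _ + _]addrC. Qed.

End mac_rates.

(** * Sum-rate optimality, equilibria and weighted optimality *)

Section mac_optimality.
Context d (T : measurableType d) (R : realType).
Variables (mu : {measure set T -> \bar R}) (D : set T) (f : T -> R) (s2 : R).
Hypotheses (s2_gt0 : 0 < s2)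
  (mD : measurable D) (f_ge0 : forall x, D x -> 0 <= f x)
  (mf : measurable_fun D f) (f_int1 : (\int[mu]_(x in D) (f x)%:E = 1)%E).

Local Notation E := (expect mu D f).
Local Notation ae P := (ae_dens mu D f P).
Local Notation nrate := (nrate mu D f).
Local Notation sum_rate := (sum_rate mu D f s2).
Local Notation noise := (noise s2).
Local Notation budget := (budget mu D f).
Local Notation nash := (nash mu D f s2).
Local Notation best_response := (best_response mu D f).

(** Mutual water-filling against full interference is the Karush-Kuhn-Tucker condition of the
    concave sum-rate problem. The proof integrates [joint_waterfill_tangent] with the multipliers
    [k1] and [k2]. *)
Lemma joint_waterfill_optimal g1 g2 l1 l2 Pb1 Pb2 P1 P2 Q1 Q2 :
  mpos D g1 -> mpos D g2 -> 0 < l1 -> 0 < l2 ->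
  mnonneg D P1 -> mnonneg D P2 -> E P1 = Pb1%:E -> E P2 = Pb2%:E ->
  ae (fun x => P1 x = waterfill l1 (fun x => (s2 + P2 x * g2 x) / g1 x) x) ->
  ae (fun x => P2 x = waterfill l2 (fun x => (s2 + P1 x * g1 x) / g2 x) x) ->
  budget Pb1 Q1 -> budget Pb2 Q2 ->
  (sum_rate g1 g2 Q1 Q2 <= sum_rate g1 g2 P1 P2)%E.
Proof.
move=> g10 g20 l10 l20 P10 P20 EP1 EP2 e1 e2 [Q10 EQ1] [Q20 EQ2].
set k1 := @rate_slope R / l1; set k2 := @rate_slope R / l2.
have k10 : 0 <= k1 by rewrite ltW// divr_gt0 ?rate_slope_gt0.
have k20 : 0 <= k2 by rewrite ltW// divr_gt0 ?rate_slope_gt0.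
have cost0 U V : mnonneg D U -> mnonneg D V ->
    mnonneg D (fun x => k1 * U x + k2 * V x).
  by move=> U0 V0; apply: mnonnegD; exact: mnonnegZ.
have costE U V : mnonneg D U -> mnonneg D V ->
    E (fun x => k1 * U x + k2 * V x) = (k1%:E * E U + k2%:E * E V)%E.
  by move=> U0 V0; rewrite expectD//; do ?exact: mnonnegZ; rewrite !expectZ.
have EP : E (fun x => k1 * P1 x + k2 * P2 x) = (k1 * Pb1 + k2 * Pb2)%:E.
  by rewrite costE// EP1 EP2.
rewrite -(@leeD2rE _ (k1 * Pb1 + k2 * Pb2)%:E)//.
apply: (@le_trans _ _ (sum_rate g1 g2 P1 P2 +
                       E (fun x => k1 * Q1 x + k2 * Q2 x)%R)%E); last first.
  rewrite leeD2l// costE// EFinD.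
  rewrite [(k1 * _)%:E]EFinM [(k2 * _)%:E]EFinM.
  by apply: leeD; rewrite lee_wpmul2l.
rewrite -EP -!expectD//; do ?[exact: sum_rate_mnonneg|exact: cost0].
apply: expect_le => //; do ?by apply: mnonnegD;
  [exact: sum_rate_mnonneg|exact: cost0].
apply: ae_densS2 e1 e2 => x Dx e1 e2.
apply: joint_waterfill_tangent => //.
- exact: g10.2.
- exact: g20.2.
- exact: Q10.2.
- exact: Q20.2.
Qed.

Lemma best_response_eq_ae Pb a a' P : mpos D a -> mpos D a' ->
  ae (fun x => a x = a' x) -> best_response Pb a P -> best_response Pb a' P.
Proof.
move=> a0 a'0 aa' [[P0 EP] Pmax].
have eq_cap Q : mnonneg D Q -> E (capacity Q a) = E (capacity Q a').
  move=> Q0; apply: expect_eq => //; do ?exact: capacity_mnonneg.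
  by apply: ae_densS aa' => x _ aa'; rewrite /capacity aa'.
split=> // Q [Q0 EQ]; rewrite -!eq_cap//; exact: Pmax.
Qed.

Lemma nrate_orthogonal A g g' P P' : measurable A -> mpos D g -> mpos D g' ->
  mnonneg D P -> mnonneg D P' -> ae (fun x => A x -> P x = 0 \/ P' x = 0) ->
  nrate (noise A g' P') g P = nrate (cst s2) g P.
Proof.
move=> mA g0 g'0 P0 P'0 orth; apply: expect_eq => //.
- by apply: nrate_mnonneg => //; exact: noise_mpos.
- by apply: nrate_mnonneg => //; exact: mpos_cst.
apply: ae_densS orth => x _ orth; rewrite /noise /= indicE.
case: (boolP (x \in A)) => [/set_mem/orth[->|->]|_].
- by rewrite !mul0r.
- by rewrite !mul0r addr0.
- by rewrite mulr0 addr0.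
Qed.

Lemma noise_in A (g P : T -> R) x : A x -> noise A g P x = s2 + P x * g x.
Proof. by move=> Ax; rewrite /noise indicE mem_set// mulr1. Qed.

Lemma noise_out A (g P : T -> R) x : ~ A x -> noise A g P x = s2.
Proof. by move=> Ax; rewrite /noise indicE memNset// mulr0 addr0. Qed.

Lemma interference_mpos (g P : T -> R) : mpos D g -> mnonneg D P ->
  mpos D (fun x => s2 + P x * g x).
Proof. by move=> g0 P0; rewrite -noise_setT; exact: noise_mpos. Qed.

(** With user 1 decoded first everywhere, the sum rate is a term free of [P1] plus the rate of user
    1 under full interference; maximising the sum over [P1] therefore maximises the latter. *)
Lemma sum_optimal_best_response g1 g2 Pb1 P1 P2 (v : R) :
  mpos D g1 -> mpos D g2 -> budget Pb1 P1 -> mnonneg D P2 ->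
  sum_rate g1 g2 P1 P2 = v%:E ->
  (forall Q1, budget Pb1 Q1 -> (sum_rate g1 g2 Q1 P2 <= v%:E)%E) ->
  best_response Pb1 (fun x => (s2 + P2 x * g2 x) / g1 x) P1 /\
  (E (capacity P1 (fun x => (s2 + P2 x * g2 x) / g1 x))%R < +oo)%E.
Proof.
move=> g10 g20 bP1 P20 vE vmax; have N0 := interference_mpos g20 P20.
have split_rate Q1 : mnonneg D Q1 -> sum_rate g1 g2 Q1 P2 =
    (nrate (cst s2) g2 P2 +
     E (capacity Q1 (fun x => (s2 + P2 x * g2 x) / g1 x))%R)%E.
  by move=> Q10; rewrite sum_rateC -nrate_sum_decode2// [X in (_ + X)%E]nrateE.
have X0 : (0 <= nrate (cst s2) g2 P2)%E by apply: nrate_ge0 => //; exact: mpos_cst.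
have Y0 : (0 <= E (capacity P1 (fun x => (s2 + P2 x * g2 x) / g1 x))%R)%E.
  by apply: expect_ge0 => //; apply: capacity_mnonneg (mpos_div N0 g10); case: bP1.
have [P10 _] := bP1; have := vE; rewrite split_rate// => XY.
have Xfin : nrate (cst s2) g2 P2 \is a fin_num.
  by rewrite ge0_fin_numE// (le_lt_trans _ (ltry v))// -XY leeDl.
split; last by rewrite (le_lt_trans _ (ltry v))// -XY leeDr.
split=> // Q1 bQ1; have [Q10 _] := bQ1; have := vmax _ bQ1.
by rewrite split_rate// -XY leeD2lE.
Qed.

Lemma sum_optimal_nash g1 g2 Pb1 Pb2 P1 P2 (v : R) :
  mpos D g1 -> mpos D g2 -> (forall c, 0 < c -> ae (fun x => g2 x <> c * g1 x)) ->
  0 < Pb1 -> 0 < Pb2 -> budget Pb1 P1 -> budget Pb2 P2 ->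
  sum_rate g1 g2 P1 P2 = v%:E ->
  (forall Q1 Q2, budget Pb1 Q1 -> budget Pb2 Q2 ->
     (sum_rate g1 g2 Q1 Q2 <= v%:E)%E) ->
  let A := D `&` [set x | 0 < P2 x] in
  [/\ measurable A, nash Pb1 Pb2 g1 g2 A P1 P2,
      nrate (noise A g2 P2) g1 P1 = nrate (cst s2) g1 P1 &
      nrate (noise (~` A) g1 P1) g2 P2 = nrate (cst s2) g2 P2].
Proof.
move=> g10 g20 null Pb10 Pb20 bP1 bP2 vE vmax A.
have [P10 _] := bP1; have [P20 _] := bP2.
have mA : measurable A.
  by have := P20.1 mD `]0, +oo[%classic (measurable_itv _);
    congr measurable; apply/seteqP; split=> x /=; rewrite in_itv /= andbT.
have [br1 fin1] := sum_optimal_best_response g10 g20 bP1 P20 vE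
  (fun Q1 bQ1 => vmax Q1 P2 bQ1 bP2).
have [br2 fin2] := sum_optimal_best_response g20 g10 bP2 P10
  (etrans (sum_rateC _ _ _ _ _ _ _ _) vE)
  (fun Q2 bQ2 => eq_ind _ (fun z => (z <= v%:E)%E) (vmax P1 Q2 bP1 bQ2) _
    (sum_rateC _ _ _ _ _ _ _ _)).
have N10 := interference_mpos g20 P20; have N20 := interference_mpos g10 P10.
have [l1 l10 [_ e1]] := best_responseP mD f_ge0 mf f_int1 Pb10 (mpos_div N10
  g10) br1 fin1.
have [l2 l20 [_ e2]] := best_responseP mD f_ge0 mf f_int1 Pb20 (mpos_div N20
  g20) br2 fin2.
(* Where both users are active, [l1 * g1] and [l2 * g2] both equal noise plus total received power,
   which confines the state to the null line of slope [l1 / l2]. *)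
have c0 : 0 < l1 / l2 by rewrite divr_gt0.
have orth : ae (fun x => P1 x = 0 \/ P2 x = 0).
  apply: ae_densS3 e1 e2 (null _ c0) => x Dx e1 e2 ratio.
  have [|P1x] := eqVneq (P1 x) 0; first by left.
  have [|P2x] := eqVneq (P2 x) 0; first by right.
  have h1 := waterfill_active (g10.2 x Dx) e1 P1x.
  have h2 := waterfill_active (g20.2 x Dx) e2 P2x.
  have e : l1 * g1 x = l2 * g2 x by rewrite -h1 -h2 addrAC.
  by case: ratio; rewrite mulrAC e mulrAC divff ?mul1r// gt_eqF.
split=> //.
- split.
    apply: best_response_eq_ae br1; [exact: mpos_div|apply: mpos_div => //;
      exact: noise_mpos|].
    (* Off [A] user 2 is silent, so the noise of user 1 in the game coincides with full
       interference. *)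
    apply: ae_densW => x Dx; have [P2x|P2x] := pselect (0 < P2 x).
      by rewrite noise_in.
    rewrite noise_out => [|[]//].
    have := P20.2 x Dx; rewrite le_eqVlt => /predU1P[<-|//].
    by rewrite mul0r addr0.
  apply: best_response_eq_ae br2; [exact: mpos_div|apply: mpos_div => //;
    apply: noise_mpos => //; exact: measurableC|].
  (* On [A] user 1 is silent by orthogonality, so user 2 loses nothing by being decoded last
     there. *)
  apply: ae_densS orth => x Dx orth; have [Ax|Ax] := pselect (A x).
    rewrite noise_out; last exact.
    case: orth => [->|P2x]; first by rewrite mul0r addr0.
    by case: Ax => _ /=; rewrite P2x ltxx.
  by rewrite noise_in.
- by apply: nrate_orthogonal => //; apply: ae_densS orth => x _ ? _.
- apply: nrate_orthogonal => //; first exact: measurableC.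
  by apply: ae_densS orth => x _ [] ? _; [right|left].
Qed.

Lemma best_response_value a Pb P Q : best_response Pb a P ->
  best_response Pb a Q -> E (capacity P a) = E (capacity Q a).
Proof.
move=> [bP maxP] [bQ maxQ].
by apply/eqP; rewrite eq_le maxP// maxQ.
Qed.

Lemma waterfill_best_response l a Pb : 0 < Pb -> mpos D a ->
  E (waterfill l a) = Pb%:E -> best_response Pb a (waterfill l a).
Proof.
move=> Pb0 a0 EW; have l0 := waterfill_level_gt0 mD f_ge0 mf f_int1 Pb0 a0 EW.
split; first by split; [exact: waterfill_mnonneg|rewrite EW].
by move=> Q bQ; have [] := waterfill_optimal mD f_ge0 mf l0 a0 EW bQ.
Qed.

(** User 1 never meets interference, so its equilibrium policy is the single-user water-filling up
    to null states; this fixes the noise of user 2 and hence its equilibrium rate. All equilibria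
    thus have the same payoffs and none dominates another. [A] is only asked to miss [D], so that
    the lemma also applies with the users exchanged. *)
Lemma corner_nash A g1 g2 l1 l2 Pb1 Pb2 : measurable A ->
  (forall x, D x -> ~ A x) -> mpos D g1 -> mpos D g2 -> 0 < Pb1 -> 0 < Pb2 ->
  let P1 := waterfill l1 (fun x => s2 / g1 x) in
  let P2 := waterfill l2 (fun x => (s2 + P1 x * g1 x) / g2 x) in
  E P1 = Pb1%:E -> E P2 = Pb2%:E -> (nrate (cst s2) g1 P1 < +oo)%E ->
  nash Pb1 Pb2 g1 g2 A P1 P2 /\
  forall Q1 Q2, nash Pb1 Pb2 g1 g2 A Q1 Q2 ->
    nrate (noise A g2 Q2) g1 Q1 = nrate (cst s2) g1 P1 /\
    nrate (noise (~` A) g1 Q1) g2 Q2 =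
      nrate (fun x => s2 + P1 x * g1 x) g2 P2.
Proof.
move=> mA nA g10 g20 Pb10 Pb20 P1 P2 EP1 EP2 fin1.
have a10 := mpos_div (mpos_cst D s2_gt0) g10.
have P10 : mnonneg D P1 by exact: waterfill_mnonneg.
have N20 := interference_mpos g10 P10; have a20 := mpos_div N20 g20.
have P20 : mnonneg D P2 by exact: waterfill_mnonneg.
have br1 := waterfill_best_response Pb10 a10 EP1.
have br2 := waterfill_best_response Pb20 a20 EP2.
have nA1 P : mnonneg D P -> mpos D (fun x => noise A g2 P x / g1 x).
  by move=> P0; apply: mpos_div => //; exact: noise_mpos.
have nA2 P : mnonneg D P -> mpos D (fun x => noise (~` A) g1 P x / g2 x).
  by move=> P0; apply: mpos_div => //; apply: noise_mpos => //; exact: measurableC.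
have eq1 P : ae (fun x => noise A g2 P x = cst s2 x).
  by apply: ae_densW => x Dx; rewrite noise_out//; exact: nA.
have eq2 P : ae (fun x => noise (~` A) g1 P x = s2 + P x * g1 x).
  by apply: ae_densW => x Dx; rewrite noise_in//; exact: nA.
split.
  split; [apply: best_response_eq_ae br1|apply: best_response_eq_ae br2] => //.
  - exact: nA1.
  - by apply: ae_densS (eq1 P2) => x _ ->.
  - exact: nA2.
  - by apply: ae_densS (eq2 P1) => x _ ->.
move=> Q1 Q2 [br1' br2']; have [Q10 _] := br1'.1; have [Q20 _] := br2'.1.
have {}br1' : best_response Pb1 (fun x => cst s2 x / g1 x) Q1.
  apply: best_response_eq_ae br1' => //; first exact: nA1.
  by apply: ae_densS (eq1 Q2) => x _ ->.
have l10 := waterfill_level_gt0 mD f_ge0 mf f_int1 Pb10 a10 EP1.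
have QP1 : ae (fun x => Q1 x = P1 x).
  have [_] := waterfill_optimal mD f_ge0 mf l10 a10 EP1 br1'.1.
  by apply; rewrite (best_response_value br1' br1) -?nrateE.
have {}br2' : best_response Pb2 (fun x => (s2 + P1 x * g1 x) / g2 x) Q2.
  apply: best_response_eq_ae br2' => //; first exact: nA2.
  by apply: ae_densS2 (eq2 Q1) QP1 => x _ -> ->.
split.
  by apply: nrate_eq => //; exact: noise_mpos.
transitivity (nrate (fun x => s2 + P1 x * g1 x) g2 Q2).
  apply: nrate_eq => //.
  - by apply: noise_mpos => //; exact: measurableC.
  - by apply: ae_densS2 (eq2 Q1) QP1 => x _ -> ->.
  - exact: ae_densW.
by rewrite !nrateE (best_response_value br2' br2).
Qed.

Lemma ae_dens_forall (P : nat -> T -> Prop) :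
  (forall n, ae (P n)) -> ae (fun x => forall n, P n x).
Proof.
move=> aeP; have : mu.-negligible
    (\bigcup_n ~` [set x | D x -> 0 < f x -> P n x]).
  by apply: negligible_bigcup => n; exact: aeP.
apply: negligibleS => x /= nP; apply: contrapT => nU; apply: nP => Dx fx n.
by apply: contrapT => nPn; apply: nU; exists n => //= /(_ Dx fx).
Qed.

(** Let [S] be the set of thresholds below which [r] falls on a non-null part of [B]. If no pair
    [u < v] separated two non-null parts, [r] would equal [inf S] almost surely on [B], against the
    absence of atoms, or against [r > 0] if [inf S <= 0]. *)
Lemma atomless_split (B : T -> Prop) (r : T -> R) :
  (forall x, D x -> 0 < r x) -> (forall c, 0 < c -> ae (fun x => r x <> c)) ->
  ~ ae (fun x => ~ B x) ->
  exists u v, [/\ 0 < u, u < v, ~ ae (fun x => ~ (B x /\ r x <= u)) &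
                  ~ ae (fun x => ~ (B x /\ v <= r x))].
Proof.
move=> r0 atomless nB; pose S := [set t | ~ ae (fun x => ~ (B x /\ r x <= t))].
have Spos t : S t -> 0 < t.
  move=> St; rewrite ltNge; apply/negP => t0; apply: St.
  by apply: ae_densW => x Dx [_]; have := r0 x Dx; lra.
have S_nonempty : S !=set0.
  apply: contrapT => S0; apply: nB.
  have /ae_dens_forall : forall n : nat, ae (fun x => ~ (B x /\ r x <= n%:R)).
    by move=> n; apply: contrapT => Sn; apply: S0; exists n%:R.
  apply: ae_densS => x Dx nBr Bx; apply: (nBr (Num.truncn (r x)).+1); split=> //.
  exact/ltW/truncnS_gt.
have S_lb : has_lbound S by exists 0 => t /Spos/ltW.
apply: contrapT => nosplit; apply: nB.
have above n : ae (fun x => ~ (B x /\ inf S + n.+1%:R^-1 <= r x)).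
  have n0 : 0 < n.+1%:R^-1 :> R by rewrite invr_gt0 ltr0n.
  have [t St tlt] := inf_adherent n0 (conj S_nonempty S_lb).
  apply: contrapT => nae; apply: nosplit.
  by exists t, (inf S + n.+1%:R^-1); split => //; exact: Spos.
have below n : ae (fun x => ~ (B x /\ r x <= inf S - n.+1%:R^-1)).
  apply: contrapT => St; have := ge_inf S_lb St.
  by rewrite leNgt ltrBlDr ltrDl invr_gt0 ltr0n.
have level : ae (fun x => B x -> r x <> inf S).
  have [S0|S0] := ltP 0 (inf S).
    by apply: ae_densS (atomless _ S0) => x _ ? _.
  by apply: ae_densW => x Dx _ e; have := r0 x Dx; rewrite e ltNge S0.
apply: ae_densS3 (ae_dens_forall above) (ae_dens_forall below) level.
move=> x Dx ab be lv Bx; have := lv Bx; apply; apply/eqP; rewrite eq_le.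
apply/andP; split; rewrite leNgt; apply/negP => h.
  rewrite -subr_gt0 in h; have [n _ nr] := near_infty_natSinv_lt (PosNum h).
  by apply: (ab n); split => //; rewrite -lerBrDl ltW//; exact: (nr n (leqnn n)).
rewrite -subr_gt0 in h; have [n _ nr] := near_infty_natSinv_lt (PosNum h).
apply: (be n); split => //; rewrite lerBrDr addrC -lerBrDr ltW//.
exact: (nr n (leqnn n)).
Qed.

Lemma measurable_setI_ge (P : T -> R) c : measurable_fun D P ->
  measurable (D `&` [set x | c <= P x]).
Proof.
move=> mP; have := mP mD `[c, +oo[%classic (measurable_itv _).
by congr measurable; apply/seteqP; split=> x /=; rewrite in_itv /= andbT.
Qed.

Lemma measurable_setI_gt (P : T -> R) c : measurable_fun D P ->
  measurable (D `&` [set x | c < P x]).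
Proof.
move=> mP; have := mP mD `]c, +oo[%classic (measurable_itv _).
by congr measurable; apply/seteqP; split=> x /=; rewrite in_itv /= andbT.
Qed.

Lemma expect_indic_fin A : measurable A -> E (\1_A) \is a fin_num.
Proof.
move=> mA; apply: (expect_fin mD f_ge0 mf (mnonneg_indic R D mA) (mnonneg_cst D
  ler01)).
  by apply: ae_densW => x Dx; rewrite indicE; case: (_ \in _).
by rewrite expect_cst ?ltry.
Qed.

Lemma fine_expect_indic A : measurable A -> ~ ae (fun x => ~ A x) ->
  0 < fine (E (\1_A)) <= 1 /\ E (\1_A) = (fine (E (\1_A)))%:E.
Proof.
move=> mA nA; have finA := expect_indic_fin mA; rewrite fineK//; split=> //.
apply/andP; split; last first.
  rewrite -lee_fin fineK// -(expect_cst mD f_ge0 mf f_int1 ler01).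
  apply: (expect_le mD f_ge0 mf (mnonneg_indic R D mA) (mnonneg_cst D ler01)).
  by apply: ae_densW => x Dx; rewrite indicE; case: (_ \in _).
apply: fine_gt0; rewrite lt0e (expect_ge0 mu f_ge0 (mnonneg_indic R D mA)) andbT.
apply/andP; split; last by rewrite ltey_eq finA.
by apply/eqP => /(expect_indic_eq0 mD f_ge0 mf f_int1 mA).
Qed.

Lemma weighted_rate_mnonneg (c k : R) (g1 g2 Q P2 : T -> R) :
  0 <= c -> 0 <= k -> mpos D g1 -> mpos D g2 -> mnonneg D Q -> mnonneg D P2 ->
  mnonneg D (fun x => weighted_rate c k s2 (g1 x) (P2 x * g2 x) (Q x)).
Proof.
move=> c0 k0 g10 g20 Q0 P20.
apply: mnonnegD; apply: mnonnegZ => //; last exact: sum_rate_mnonneg.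
exact: (nrate_mnonneg (mpos_cst D s2_gt0) g10 Q0).
Qed.

(* On the states where both users are active the marginal value of the power of
   user 1 is a decreasing function of [g2 / g1], which is not constant on any
   non-null set: moving power between two of its levels would be profitable. *)
Lemma no_overlap g1 g2 (c k l1 l2 Pb1 V : R) P1 P2 :
  mpos D g1 -> mpos D g2 -> (forall c, 0 < c -> ae (fun x => g2 x <> c * g1 x)) ->
  0 <= c -> 0 < k -> 0 < l1 -> 0 < l2 -> budget Pb1 P1 -> mnonneg D P2 ->
  ae (fun x => P1 x != 0 -> P2 x != 0 ->
    s2 + P1 x * g1 x = l1 * g1 x /\ s2 + P1 x * g1 x + P2 x * g2 x = l2 * g2 x) ->
  E (fun x => weighted_rate c k s2 (g1 x) (P2 x * g2 x) (P1 x)) = V%:E ->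
  (forall Q, budget Pb1 Q ->
    (E (fun x => weighted_rate c k s2 (g1 x) (P2 x * g2 x)%R (Q x)) <= V%:E)%E) ->
  ae (fun x => P1 x = 0 \/ P2 x = 0).
Proof.
move=> g10 g20 null c0 k0 l10 l20 [P10 EP1] P20 active EV Vmax.
have k0' := ltW k0.
pose r x := g2 x / g1 x.
have r0 : mpos D r by exact: mpos_div.
apply: contrapT => overlap.
have nB : ~ ae (fun x => ~ (0 < P1 x /\ 0 < P2 x)).
  move=> H; apply: overlap; apply: ae_densS H => x Dx nB.
  have := P10.2 x Dx; rewrite le_eqVlt => /predU1P[<-|P1x]; first by left.
  have := P20.2 x Dx; rewrite le_eqVlt => /predU1P[<-|P2x]; first by right.
  by case: nB.
have r_atomless z : 0 < z -> ae (fun x => r x <> z).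
  move=> z0; apply: ae_densS (null _ z0) => x Dx + rz; apply.
  by rewrite -rz /r mulfVK// gt_eqF// g10.2.
have [u [v [u0 uv nB1 nB2]]] := atomless_split r0.2 r_atomless nB.
(* A uniform lower bound on the power where it will be reduced keeps the modified policy
   nonnegative. *)
have [a a0 nB2a] : exists2 a, 0 < a & ~ ae (fun x => ~ (a <= P1 x /\ 0 < P2 x
  /\ v <= r x)).
  apply: contrapT => na; apply: nB2.
  have /ae_dens_forall : forall n : nat,
      ae (fun x => ~ (n.+1%:R^-1 <= P1 x /\ 0 < P2 x /\ v <= r x)).
    by move=> n; apply: contrapT => nn; apply: na; exists n.+1%:R^-1 => //;
      rewrite invr_gt0 ltr0n.
  apply: ae_densS => x Dx H [[P1x P2x] vr].
  have [n _ nP] := near_infty_natSinv_lt (PosNum P1x).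
  by apply: (H n); split => //; apply: ltW; exact: (nP n (leqnn n)).
(* Power moves from [B2], where [r] is large and its marginal value low, to [B1], where [r] is
   small. *)
pose B1 := (D `&` [set x | 0 < P1 x]) `&` (D `&` [set x | 0 < P2 x]) `&`
           (D `&` [set x | - u <= - r x]).
pose B2 := (D `&` [set x | a <= P1 x]) `&` (D `&` [set x | 0 < P2 x]) `&`
           (D `&` [set x | v <= r x]).
have mB1 : measurable B1.
  apply: measurableI; first apply: measurableI.
  - exact: measurable_setI_gt P10.1.
  - exact: measurable_setI_gt P20.1.
  - exact: (measurable_setI_ge (- u) (measurable_funN r0.1)).
have mB2 : measurable B2.
  apply: measurableI; first apply: measurableI.
  - exact: measurable_setI_ge P10.1.
  - exact: measurable_setI_gt P20.1.
  - exact: (measurable_setI_ge v r0.1).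
have [|/andP[m10 m1le] Em1] := fine_expect_indic mB1.
  move=> H; apply: nB1; apply: ae_densS H => x Dx + [[? ?] ru].
  by apply; split; [split|split => //=; rewrite lerN2].
have [|/andP[m20 m2le] Em2] := fine_expect_indic mB2.
  move=> H; apply: nB2a; apply: ae_densS H => x Dx + [? [? ?]].
  by apply; split; [split|split].
move: m10 m1le Em1 m20 m2le Em2.
set m1 := fine (E (\1_B1)); set m2 := fine (E (\1_B2)) => m10 m1le Em1 m20 m2le Em2.
have [e e0 small] := exists_small_step c0 k0 l10 (mulr_gt0 l20 u0)
  (etrans (ltr_pM2l l20 _ _) uv) a0.
(* The steps are weighted by the opposite masses: the power added on [B1] and the power removed on
   [B2] both have mean [e * m1 * m2]. *)
pose e1 := e * m2; pose e2 := e * m1.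
have e10 : 0 < e1 <= e by rewrite mulr_gt0//= ler_piMr// ltW.
have e20 : 0 < e2 <= e by rewrite mulr_gt0//= ler_piMr// ltW.
have [e2a e2l e2v gain] := small _ _ e10 e20.
move/andP: e10 => [e10 _]; move/andP: e20 => [e20 _].
have I1 : mnonneg D (fun x => e1 * \1_B1 x).
  exact: mnonnegZ (ltW e10) (mnonneg_indic R D mB1).
have I2 : mnonneg D (fun x => e2 * \1_B2 x).
  exact: mnonnegZ (ltW e20) (mnonneg_indic R D mB2).
have in1 (A : set T) x : A x -> \1_A x = 1 :> R.
  by move=> Ax; rewrite indicE mem_set.
have in0 (A : set T) x : ~ A x -> \1_A x = 0 :> R.
  by move=> Ax; rewrite indicE memNset.
have disj x : B1 x -> ~ B2 x.
  by move=> [_ [_ /= ru]] [_ [_ /= vr]]; move: ru; rewrite lerN2; lra.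
pose Q x := P1 x + e1 * \1_B1 x - e2 * \1_B2 x.
have Q_B1 x : B1 x -> Q x = P1 x + e1.
  by move=> B1x; rewrite /Q in1// in0 ?mulr1 ?mulr0 ?subr0//; exact: disj.
have Q_B2 x : B2 x -> Q x = P1 x + - e2.
  by move=> B2x; rewrite /Q in0 ?(in1 B2)// ?mulr1 ?mulr0 ?addr0// => /disj.
have Q_out x : ~ B1 x -> ~ B2 x -> Q x = P1 x.
  by move=> B1x B2x; rewrite /Q !in0// !mulr0 addr0 subr0.
have Q0 : mnonneg D Q.
  split.
    by apply: measurable_funB; [apply: measurable_funD;
      [case: P10|case: I1]|case: I2].
  move=> x Dx; have P1x := P10.2 x Dx.
  have [B1x|B1x] := pselect (B1 x); first by rewrite Q_B1// addr_ge0// ltW.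
  have [B2x|B2x] := pselect (B2 x); last by rewrite Q_out.
  by rewrite Q_B2//; have [[[_ /= aP] _] _] := B2x; lra.
have EQ : E Q = E P1.
  have : (E Q + (e * m1 * m2)%:E = E P1 + (e * m1 * m2)%:E)%E.
    have {1}-> : (e * m1 * m2)%:E = E (fun x => e2 * \1_B2 x).
      by rewrite (expectZ mu mD f_ge0 mf (ltW e20) (mnonneg_indic R D mB2)) Em2.
    have -> : (e * m1 * m2)%:E = E (fun x => e1 * \1_B1 x).
      by rewrite (expectZ mu mD f_ge0 mf (ltW e10) (mnonneg_indic R D mB1)) Em1
        -EFinM mulrAC.
    rewrite -!expectD//; congr expect; apply/funext => x.
    by rewrite /Q subrK.
  exact: adde_fin_inj.
have bQ : budget Pb1 Q by split; rewrite ?EQ.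
pose phi Q' x := weighted_rate c k s2 (g1 x) (P2 x * g2 x) (Q' x).
have phi0 Q' : mnonneg D Q' -> mnonneg D (phi Q').
  by move=> Q'0; exact: weighted_rate_mnonneg.
(* [d1] bounds the gain per state on [B1] from below, [d2] the loss per state on [B2] from above.
   Optimality will give [d1 * m1 <= d2 * m2], against the choice of [e]. *)
pose d1 := rate_slope * e1 * (c / (l1 + e1) + k / (l2 * u + e1)).
pose d2 := rate_slope * e2 * (c / (l1 - e2) + k / (l2 * v - e2)).
have price_ge0 (y z t : R) : 0 < t -> 0 < y -> 0 < z ->
    0 <= rate_slope * t * (c / y + k / z).
  move=> t0 y0 z0; apply: mulr_ge0; first by rewrite mulr_ge0 ?ltW ?rate_slope_gt0.
  by apply: addr_ge0; apply: divr_ge0 => //; exact: ltW.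
have d10 : 0 <= d1 by apply: price_ge0; rewrite ?addr_gt0// mulr_gt0.
have d20 : 0 <= d2 by apply: price_ge0; rewrite ?subr_gt0.
have J1 : mnonneg D (fun x => d1 * \1_B1 x) by exact: mnonnegZ d10
  (mnonneg_indic R D mB1).
have J2 : mnonneg D (fun x => d2 * \1_B2 x) by exact: mnonnegZ d20
  (mnonneg_indic R D mB2).
have pointwise : ae (fun x => phi P1 x + d1 * \1_B1 x <= phi Q x + d2 * \1_B2 x).
  apply: ae_densS active => x Dx act.
  have g1x := g10.2 x Dx; have P1x := P10.2 x Dx; have P2x := P20.2 x Dx.
  have w0 : 0 <= P2 x * g2 x by rewrite mulr_ge0// ltW// g20.2.
  have Qx := Q0.2 x Dx.
  have ratio_le z : (l2 * g2 x <= l2 * z * g1 x) = (r x <= z).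
    by rewrite /r ler_pdivrMr// -mulrA ler_pM2l.
  have ratio_ge z : (l2 * z * g1 x <= l2 * g2 x) = (z <= r x).
    by rewrite /r ler_pdivlMr// -mulrA ler_pM2l.
  have [B1x|B1x] := pselect (B1 x).
    rewrite in1// (in0 B2) ?mulr1 ?mulr0 ?addr0; last exact: disj.
    have [[[_ /= P1p] [_ /= P2p]] [_ /= ru]] := B1x; rewrite lerN2 in ru.
    have [h1 h2] := act (lt0r_neq0 P1p) (lt0r_neq0 P2p).
    rewrite Q_B1// in Qx; rewrite /phi Q_B1//.
    apply: weighted_rate_shift h1 h2 _ _ => //.
      by rewrite addr_gt0// mulr_gt0.
    by rewrite ler_wpM2l ?ratio_le// ltW.
  have [B2x|B2x] := pselect (B2 x).
    rewrite (in0 B1)// (in1 B2)// mulr1 mulr0 addr0.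
    have [[[_ /= aP] [_ /= P2p]] [_ /= vr]] := B2x.
    have [h1 h2] := act (lt0r_neq0 (lt_le_trans a0 aP)) (lt0r_neq0 P2p).
    rewrite Q_B2// in Qx; rewrite /phi Q_B2// -lerBlDr.
    have -> : - d2 = rate_slope * - e2 * (c / (l1 + - e2) + k / (l2 * v + - e2)).
      by rewrite /d2 mulrN mulNr.
    apply: weighted_rate_shift h1 h2 _ _ => //; first by rewrite subr_gt0.
    by rewrite !mulNr lerN2 ler_wpM2l ?ratio_ge// ltW.
  by rewrite !in0// !mulr0 !addr0 /phi Q_out.
have : ((V + d1 * m1)%:E <= (V + d2 * m2)%:E)%E.
  have : (E (fun x => phi P1 x + d1 * \1_B1 x)%R <=
          E (fun x => phi Q x + d2 * \1_B2 x)%R)%E.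
    by apply: expect_le => //; apply: mnonnegD => //; exact: phi0.
  rewrite (expectD mu mD f_ge0 mf (phi0 _ P10) J1).
  rewrite (expectD mu mD f_ge0 mf (phi0 _ Q0) J2).
  rewrite (expectZ mu mD f_ge0 mf d10 (mnonneg_indic R D mB1)).
  rewrite (expectZ mu mD f_ge0 mf d20 (mnonneg_indic R D mB2)).
  rewrite Em1 Em2 EV !EFinD => /le_trans; apply.
  by rewrite leeD2r//; exact: Vmax.
rewrite lee_fin lerD2l leNgt => /negP; apply; rewrite /d1 /d2.
have -> : rate_slope * e2 * (c / (l1 - e2) + k / (l2 * v - e2)) * m2 =
  (rate_slope * e * m1 * m2) * (c / (l1 - e2) + k / (l2 * v - e2)).
  by rewrite {1}/e2; ring.
have -> : rate_slope * e1 * (c / (l1 + e1) + k / (l2 * u + e1)) * m1 =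
  (rate_slope * e * m1 * m2) * (c / (l1 + e1) + k / (l2 * u + e1)).
  by rewrite {1}/e1; ring.
by rewrite ltr_pM2l// 3?mulr_gt0// rate_slope_gt0.
Qed.

(** Off [A] the interference is added to the noise. This changes nothing if it is zero, and if the
    power is already zero, a higher noise keeps it at zero. *)
Lemma waterfill_full_noise A l (g g' P P' : T -> R) x :
  0 < g x -> 0 <= P' x * g' x -> (~ A x -> P x = 0 \/ P' x = 0) ->
  P x = waterfill l (fun x => noise A g' P' x / g x) x ->
  P x = waterfill l (fun x => (s2 + P' x * g' x) / g x) x.
Proof.
move=> gx Ix orth; rewrite /waterfill => e.
have [Ax|Ax] := pselect (A x); first by rewrite e noise_in.
case: (orth Ax) => z; last by rewrite e noise_out// z mul0r addr0.
rewrite z; apply/esym/max_r.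
have : l - s2 / g x <= 0 by rewrite -z e noise_out// le_max lexx.
by apply: le_trans; rewrite lerD2l lerN2 ler_wpM2r ?lerDl// invr_ge0 ltW.
Qed.

(** The two alternatives are the first corner point and sum-rate optimality. The weighted optimum is
    tested only against decoding user 2 first, the order that favours the user of larger weight. *)
Lemma boundary_nash A g1 g2 (Pb1 Pb2 mu1 mu2 p1 p2 : R) P1 P2 :
  measurable A -> mpos D g1 -> mpos D g2 ->
  (forall c, 0 < c -> ae (fun x => g2 x <> c * g1 x)) ->
  0 < Pb1 -> 0 < Pb2 -> 0 <= mu2 -> mu2 < mu1 ->
  nash Pb1 Pb2 g1 g2 A P1 P2 ->
  nrate (noise A g2 P2) g1 P1 = p1%:E ->
  nrate (noise (~` A) g1 P1) g2 P2 = p2%:E ->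
  (forall Q1 Q2, budget Pb1 Q1 -> budget Pb2 Q2 -> forall q1 q2 : R,
     (q1%:E <= nrate (cst s2) g1 Q1)%E ->
     (q2%:E <= nrate (fun x => s2 + Q1 x * g1 x)%R g2 Q2)%E ->
     mu1 * q1 + mu2 * q2 <= mu1 * p1 + mu2 * p2) ->
  (exists l1 l2,
     let W1 := waterfill l1 (fun x => s2 / g1 x) in
     let W2 := waterfill l2 (fun x => (s2 + W1 x * g1 x) / g2 x) in
     [/\ E W1 = Pb1%:E, E W2 = Pb2%:E, p1%:E = nrate (cst s2) g1 W1 &
         p2%:E = nrate (fun x => s2 + W1 x * g1 x) g2 W2]) \/
  (forall Q1 Q2, budget Pb1 Q1 -> budget Pb2 Q2 ->
     (sum_rate g1 g2 Q1 Q2 <= (p1 + p2)%:E)%E).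
Proof.
move=> mA g10 g20 null Pb10 Pb20 mu20 mu21 [br1 br2] p1E p2E wmax.
have mu10 := le_lt_trans mu20 mu21.
have [bP1 _] := br1; have [bP2 _] := br2.
have [P10 EP1] := bP1; have [P20 EP2] := bP2.
have mAC := measurableC mA.
have c0 := mpos_cst D s2_gt0.
have N10 := noise_mpos s2_gt0 mA g20 P20; have N20 := noise_mpos s2_gt0 mAC g10 P10.
have F20 := interference_mpos g10 P10.
have Ige0 P g : mnonneg D P -> mpos D g -> forall x, D x -> 0 <= P x * g x.
  by move=> P0 g0 x Dx; have [_] := mnonnegM P0 (mpos_mnonneg g0); exact.
have rate_ge0 Q1 Q2 : mnonneg D Q1 -> mnonneg D Q2 ->
    (0 <= nrate (cst s2) g1 Q1)%E /\
    (0 <= nrate (fun x => s2 + Q1 x * g1 x)%R g2 Q2)%E.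
  by move=> Q10 Q20; split; apply: nrate_ge0 => //; exact: interference_mpos.
have sumE : sum_rate g1 g2 P1 P2 = (p1 + p2)%:E.
  by rewrite -(nrate_sum mu s2_gt0 mD f_ge0 mf mA g10 g20 P10 P20) p1E p2E.
(* [a] and [b] are the rates of the same policies with user 2 decoded first everywhere. The sum is
   unchanged and [a >= p1], so [mu1 > mu2] and optimality force [a = p1]. *)
have [a [b [aE bE abE]]] : exists a b : R, [/\ nrate (cst s2) g1 P1 = a%:E,
    nrate (fun x => s2 + P1 x * g1 x) g2 P2 = b%:E & a + b = p1 + p2].
  have [r1 r2] := rate_ge0 _ _ P10 P20.
  by apply: ge0_adde_eq_fin => //; rewrite nrate_sum_decode2.
have ap1 : a = p1.
  apply/eqP; rewrite eq_le; apply/andP; split; last first.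
    by rewrite -lee_fin -p1E -aE; exact: nrate_noise_le.
  have := wmax _ _ bP1 bP2 a b; rewrite aE bE !lexx => /(_ isT isT).
  have -> : b = p1 + p2 - a by lra.
  have -> : mu1 * a + mu2 * (p1 + p2 - a) = (mu1 - mu2) * (a - p1) + (mu1 * p1
    + mu2 * p2) by ring.
  by rewrite gerDr pmulr_rle0 ?subr_gt0// subr_le0.
have bp2 : b = p2 by lra.
rewrite {}ap1 in aE; rewrite {}bp2 {abE} in bE.
have orthA : ae (fun x => A x -> P1 x = 0 \/ P2 x = 0).
  by apply: (nrate_noise_eq s2_gt0 mD f_ge0 mf mA g10 g20 P10 P20);
    rewrite ?p1E ?aE ?ltry//.
have fin1 : (E (capacity P1 (fun x => noise A g2 P2 x / g1 x))%R < +oo)%E.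
  by rewrite -nrateE p1E ltry.
have fin2 : (E (capacity P2 (fun x => noise (~` A) g1 P1 x / g2 x))%R < +oo)%E.
  by rewrite -nrateE p2E ltry.
have [l1 l10 [EW1 e1]] :=
  best_responseP mD f_ge0 mf f_int1 Pb10 (mpos_div N10 g10) br1 fin1.
have [l2 l20 [EW2 e2]] :=
  best_responseP mD f_ge0 mf f_int1 Pb20 (mpos_div N20 g20) br2 fin2.
have W1P : E P1 = Pb1%:E.
  by rewrite -EW1; apply: expect_eq => //;
    exact: waterfill_mnonneg (mpos_div N10 g10).
have W2P : E P2 = Pb2%:E.
  by rewrite -EW2; apply: expect_eq => //;
    exact: waterfill_mnonneg (mpos_div N20 g20).
have e2' : ae (fun x => P2 x = waterfill l2 (fun x => (s2 + P1 x * g1 x) / g2 x) x).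
  apply: ae_densS2 e2 orthA => x Dx e2 orth.
  apply: waterfill_full_noise e2; [exact: g20.2|exact: Ige0|].
  by move=> nnA; case: (orth (contrapT nnA)); [right|left].
move: mu20; rewrite le_eqVlt => /predU1P[mu2E|mu20].
  left; have br1' : best_response Pb1 (fun x => cst s2 x / g1 x) P1.
    split=> // Q1 bQ1; have [Q10 _] := bQ1; rewrite -!nrateE aE.
    apply: le_fin_of_minorants => q1 q1le.
    (* With [mu2 = 0] the second rate has no weight, and 0 is always an attainable value for it. *)
    have := wmax _ _ bQ1 bP2 q1 0 q1le; rewrite -mu2E !mul0r !addr0.
    by rewrite ler_pM2l//; apply; have [] := rate_ge0 _ _ Q10 P20.
  have fin1' : (E (capacity P1 (fun x => cst s2 x / g1 x))%R < +oo)%E.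
    by rewrite -nrateE aE ltry.
  have [k1 k10 [EV1 e1']] :=
    best_responseP mD f_ge0 mf f_int1 Pb10 (mpos_div c0 g10) br1' fin1'.
  exists k1, l2 => W1 W2.
  have W10 : mnonneg D W1 by exact: (waterfill_mnonneg k1 (mpos_div c0 g10)).
  have F0 := interference_mpos g10 W10.
  have W20 : mnonneg D W2 by exact: (waterfill_mnonneg l2 (mpos_div F0 g20)).
  have P2W2 : ae (fun x => P2 x = W2 x).
    by apply: ae_densS2 e1' e2' => x _ e1' ->; rewrite /W2 /waterfill e1'.
  split=> //.
  - by rewrite -W2P; apply: expect_eq => //; apply: ae_densS P2W2 => x _ ->.
  - by rewrite -aE; exact: nrate_eq (ae_densW _ _ _) e1'.
  - rewrite -bE; apply: nrate_eq => //.
    by apply: ae_densS e1' => x _ ->.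
right=> Q1 Q2 bQ1 bQ2.
have orth : ae (fun x => P1 x = 0 \/ P2 x = 0).
  have c_ge0 : 0 <= mu1 - mu2 by rewrite subr_ge0 ltW.
  have phiE Q : mnonneg D Q ->
    E (fun x => weighted_rate (mu1 - mu2) mu2 s2 (g1 x) (P2 x * g2 x) (Q x)) =
    ((mu1 - mu2)%:E * nrate (cst s2) g1 Q +
     mu2%:E * (nrate (cst s2) g1 Q + nrate (fun x => s2 + Q x * g1 x)%R g2 P2))%E.
    move=> Q0; rewrite nrate_sum_decode2//.
    rewrite -(expectZ mu mD f_ge0 mf c_ge0 (nrate_mnonneg c0 g10 Q0)).
    rewrite -(expectZ mu mD f_ge0 mf (ltW mu20) (sum_rate_mnonneg s2_gt0 g10
      g20 Q0 P20)).
    rewrite -expectD//; first exact: mnonnegZ c_ge0 (nrate_mnonneg c0 g10 Q0).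
    exact: mnonnegZ (ltW mu20) (sum_rate_mnonneg s2_gt0 g10 g20 Q0 P20).
  have valE (u v : R) : ((mu1 - mu2)%:E * u%:E + mu2%:E * (u%:E + v%:E))%E =
    (mu1 * u + mu2 * v)%:E.
    by transitivity ((mu1 - mu2) * u + mu2 * (u + v))%:E => //; congr EFin; ring.
  (* States where both users are active lie outside [A] almost surely, so user 1 sees only [s2]
     there and user 2 sees full interference: these are the two level equations required. *)
  apply: (no_overlap g10 g20 null c_ge0 mu20 l10 l20
    bP1 P20 (V := mu1 * p1 + mu2 * p2)).
  - apply: ae_densS3 e1 e2' orthA => x Dx e1 e2' oA P1x P2x.
    have nA : ~ A x by move=> /oA[] /eqP; rewrite ?(negbTE P1x) ?(negbTE P2x).
    rewrite /waterfill noise_out// in e1.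
    split; first exact: waterfill_active (g10.2 x Dx) e1 P1x.
    exact: waterfill_active (g20.2 x Dx) e2' P2x.
  - by rewrite phiE// aE bE valE.
  - move=> Q bQ; have [Q0 _] := bQ; have [x0 y0] := rate_ge0 _ _ Q0 P20.
    rewrite phiE//.
    (* Finiteness of each rate follows from the weighted bound with the other rate set to 0, both
       weights being positive. *)
    have [x xE] : exists x : R, nrate (cst s2) g1 Q = x%:E.
      apply: (@ge0_le_fin _ ((mu1 * p1 + mu2 * p2) / mu1)) => //.
      apply: le_fin_of_minorants => q1 q1le; rewrite ler_pdivlMr// mulrC.
      by have := wmax _ _ bQ bP2 q1 0 q1le y0; rewrite mulr0 addr0.
    have [y yE] : exists y : R, nrate (fun x => s2 + Q x * g1 x) g2 P2 = y%:E.
      apply: (@ge0_le_fin _ ((mu1 * p1 + mu2 * p2) / mu2)) => //.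
      apply: le_fin_of_minorants => q2 q2le; rewrite ler_pdivlMr// mulrC.
      by have := wmax _ _ bQ bP2 0 q2 x0 q2le; rewrite mulr0 add0r.
    rewrite xE yE valE lee_fin.
    by apply: (wmax _ _ bQ bP2); rewrite ?xE ?yE.
rewrite -sumE; apply: (joint_waterfill_optimal g10 g20 l10 l20 P10 P20 W1P W2P)
  => //.
apply: ae_densS2 e1 orth => x Dx e1 orth.
by apply: waterfill_full_noise e1; [exact: g10.2|exact: Ige0|].
Qed.

End mac_optimality.

(** * The fading channel *)

Section fading_channel.
Context {R : realType}.

(** [leb2] bundled as a measure, so that the general results on [expect] apply to [Ex]. *)
Definition plane_measure :
    {measure set (measurableTypeR R * measurableTypeR R) -> \bar R} :=
  (@lebesgue_measure R \x @lebesgue_measure R)%E.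

Lemma measurable_Qpos :
  measurable (@Qpos R : set (measurableTypeR R * measurableTypeR R)).
Proof.
rewrite (_ : Qpos = `]0,+oo[%classic `*` `]0,+oo[%classic); last first.
  by apply/seteqP; split => -[a b] /=; rewrite !in_itv /= !andbT.
exact: measurableX.
Qed.

Lemma fst_mpos :
  @mpos _ (measurableTypeR R * measurableTypeR R)%type R Qpos fst.
Proof. by split=> [|x []//]; exact: measurable_funTS measurable_fst. Qed.

Lemma snd_mpos :
  @mpos _ (measurableTypeR R * measurableTypeR R)%type R Qpos snd.
Proof. by split=> [|x []//]; exact: measurable_funTS measurable_snd. Qed.

(** Every vertical section of the line is a single point, hence the line is null for the product
    measure. *)
Lemma ae_dens_off_line f (c : R) :
  ae_dens plane_measure Qpos f (fun h => h.2 <> c * h.1).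
Proof.
pose N : set (measurableTypeR R * measurableTypeR R) :=
  (fun h => h.2 - c * h.1) @^-1` [set 0].
have mN : measurable N.
  rewrite -[N]setTI.
  apply: (@measurable_funB _ _ R setT snd (fun h => c * h.1)) => //.
  apply: (@measurable_funM _ _ R setT (cst c) fst) => //.
exists N; split => //; last first.
  move=> h /= H; apply: contrapT => Nh; apply: H => _ _ e; apply: Nh.
  by rewrite /N /= e subrr.
rewrite /plane_measure /= /product_measure1 integral0_eq// => x _ /=.
rewrite (_ : xsection N x = [set c * x]) ?lebesgue_measure_set1//.
apply/seteqP; split => y; rewrite /xsection /= inE /N /=.
  by move/eqP; rewrite subr_eq0 => /eqP.
by move=> ->; rewrite subrr.
Qed.

Lemma feasibleE (f P : R * R -> R) (Pb : R) :
  feasible f Pb P <-> budget plane_measure Qpos f Pb P.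
Proof. by split=> [[? ? ?]|[[? ?] ?]]; split. Qed.

Lemma is_NE_nash (f : R * R -> R) (s2 Pb1 Pb2 : R) D1 P1 P2 :
  is_NE f s2 Pb1 Pb2 D1 P1 P2 <->
  nash plane_measure Qpos f s2 Pb1 Pb2 fst snd D1 P1 P2.
Proof.
have E1 P : rate1 f s2 D1 P P2 = expect plane_measure Qpos f
    (capacity P (fun h => noise s2 D1 snd P2 h / h.1)) by rewrite -nrateE.
have E2 P : rate2 f s2 D1 P1 P = expect plane_measure Qpos f
    (capacity P (fun h => noise s2 (~` D1) fst P1 h / h.2)) by rewrite -nrateE.
split=> [[/feasibleE b1 /feasibleE b2 m1 m2]|[[b1 m1] [b2 m2]]].
  split; split=> // Q /feasibleE bQ; first by rewrite -!E1; exact: m1.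
  by rewrite -!E2; exact: m2.
split; do ?exact/feasibleE.
  by move=> Q /feasibleE bQ; rewrite !E1; exact: m1.
by move=> Q /feasibleE bQ; rewrite !E2; exact: m2.
Qed.

Lemma nash_swap f s2 Pb1 Pb2 (g1 g2 : R * R -> R) A P1 P2 :
  nash plane_measure Qpos f s2 Pb1 Pb2 g1 g2 A P1 P2 <->
  nash plane_measure Qpos f s2 Pb2 Pb1 g2 g1 (~` A) P2 P1.
Proof. by rewrite /nash setCK; split=> -[]. Qed.

End fading_channel.

(** * The capacity region and the payoff region of the game *)

Section capacity_region.
Context {R : realType}.
Variables (f : R * R -> R) (s2 Pb1 Pb2 : R).
Hypotheses (hs2 : 0 < s2) (hPb1 : 0 < Pb1) (hPb2 : 0 < Pb2)
  (f_ge0 : forall h, Qpos h -> 0 <= f h) (f_meas : measurable_fun Qpos f)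
  (f_int1 : (\int[leb2]_(h in Qpos) (f h)%:E = 1)%E).

Let mQ := @measurable_Qpos R.
Let g10 := @fst_mpos R.
Let g20 := @snd_mpos R.

Local Notation mu := (@plane_measure R).
Local Notation budget := (budget mu Qpos f).
Local Notation nrate := (nrate mu Qpos f).
Local Notation sum_rate := (sum_rate mu Qpos f s2).
Local Notation nash := (nash mu Qpos f s2).
Local Notation noise := (noise s2).

Let off_line (c : R) : 0 < c -> ae_dens mu Qpos f (fun h => h.2 <> c * h.1).
Proof. by move=> _; exact: ae_dens_off_line. Qed.

Let off_line' (c : R) : 0 < c -> ae_dens mu Qpos f (fun h => h.1 <> c * h.2).
Proof.
move=> c0; apply: ae_densS (ae_dens_off_line f c^-1) => h _ + e; apply.
by rewrite e mulKf// gt_eqF.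
Qed.

Lemma GcP (q : R * R) : Gc f s2 Pb1 Pb2 q <-> exists Q1 Q2,
  [/\ budget Pb1 Q1, budget Pb2 Q2, (q.1%:E <= nrate (cst s2) fst Q1)%E,
      (q.2%:E <= nrate (cst s2) snd Q2)%E &
      ((q.1 + q.2)%:E <= sum_rate fst snd Q1 Q2)%E].
Proof.
by split=> -[Q1 [Q2 [b1 b2 q1 q2 q12]]]; exists Q1, Q2;
  (split; [exact/feasibleE|exact/feasibleE|exact: q1|exact: q2|exact: q12]).
Qed.

Lemma Gc_decode2 Q1 Q2 (q1 q2 : R) : budget Pb1 Q1 -> budget Pb2 Q2 ->
  (q1%:E <= nrate (cst s2) fst Q1)%E ->
  (q2%:E <= nrate (fun h => s2 + Q1 h * h.1)%R snd Q2)%E ->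
  Gc f s2 Pb1 Pb2 (q1, q2).
Proof.
move=> b1 b2 q1le q2le; have [Q10 _] := b1; have [Q20 _] := b2.
apply/GcP; exists Q1, Q2; split => //=.
  apply: le_trans q2le _; rewrite -noise_setT.
  exact: (nrate_noise_le mu hs2 mQ f_ge0 f_meas measurableT g20 g10 Q20 Q10).
by rewrite EFinD -nrate_sum_decode2//; exact: leeD.
Qed.

Lemma Gc_decode1 Q1 Q2 (q1 q2 : R) : budget Pb1 Q1 -> budget Pb2 Q2 ->
  (q1%:E <= nrate (fun h => s2 + Q2 h * h.2)%R fst Q1)%E ->
  (q2%:E <= nrate (cst s2) snd Q2)%E ->
  Gc f s2 Pb1 Pb2 (q1, q2).
Proof.
move=> b1 b2 q1le q2le; have [Q10 _] := b1; have [Q20 _] := b2.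
apply/GcP; exists Q1, Q2; split => //=.
  apply: le_trans q1le _; rewrite -noise_setT.
  exact: (nrate_noise_le mu hs2 mQ f_ge0 f_meas measurableT g10 g20 Q10 Q20).
by rewrite sum_rateC addrC EFinD -nrate_sum_decode2//; exact: leeD.
Qed.

(** The bound on real points of the region first shows that both decoding rates are finite; these
    rates then form a point of the region whose coordinates add up to the sum rate. *)
Lemma Gc_max_sum_rate (v : R) :
  (forall q, Gc f s2 Pb1 Pb2 q -> q.1 + q.2 <= v) ->
  forall Q1 Q2, budget Pb1 Q1 -> budget Pb2 Q2 ->
    (sum_rate fst snd Q1 Q2 <= v%:E)%E.
Proof.
move=> vmax Q1 Q2 b1 b2; have [Q10 _] := b1; have [Q20 _] := b2.
have c0 := mpos_cst Qpos hs2; have N0 := interference_mpos hs2 g10 Q10.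
have X0 : (0 <= nrate (cst s2) fst Q1)%E by exact: nrate_ge0.
have Y0 : (0 <= nrate (fun h => s2 + Q1 h * h.1)%R snd Q2)%E by exact: nrate_ge0.
have max12 q1 q2 q1le q2le := vmax _ (@Gc_decode2 Q1 Q2 q1 q2 b1 b2 q1le q2le).
rewrite -nrate_sum_decode2//.
have [x xE] : exists x : R, nrate (cst s2) fst Q1 = x%:E.
  apply: (@ge0_le_fin _ v) => //; apply: le_fin_of_minorants => q q_le.
  by have := max12 q 0 q_le Y0; rewrite /= addr0.
have [y yE] : exists y : R, nrate (fun h => s2 + Q1 h * h.1) snd Q2 = y%:E.
  apply: (@ge0_le_fin _ v) => //; apply: le_fin_of_minorants => q q_le.
  by have := max12 0 q X0 q_le; rewrite /= add0r.
by rewrite xE yE -EFinD lee_fin; apply: (max12 x y); rewrite ?xE ?yE.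
Qed.

Lemma is_SP_of_sum_rate (p : R * R) : Gc f s2 Pb1 Pb2 p ->
  (forall Q1 Q2, budget Pb1 Q1 -> budget Pb2 Q2 ->
    (sum_rate fst snd Q1 Q2 <= (p.1 + p.2)%:E)%E) ->
  is_SP f s2 Pb1 Pb2 p.
Proof.
move=> Gp pmax; split=> // q /GcP[Q1 [Q2 [b1 b2 _ _ q12]]].
by rewrite -lee_fin (le_trans q12)// pmax.
Qed.

Lemma CR1_in_Gs p : is_CR1 f s2 Pb1 Pb2 p -> Gs f s2 Pb1 Pb2 p.
Proof.
move=> [l1 [l2 /= [EP1 EP2 p1E p2E]]].
set P1 := (fun h => _) in EP1; set P2 := (fun h => _) in EP2.
have fin1 : (nrate (cst s2) fst P1 < +oo)%E.
  by have -> : nrate (cst s2) fst P1 = p.1%:E by []; rewrite ltry.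
have [NE val] := corner_nash hs2 mQ f_ge0 f_meas f_int1 measurable0
  (fun x _ h => h) g10 g20 hPb1 hPb2 EP1 EP2 fin1.
have valP := val _ _ NE.
(* User 1 is never decoded first, so it meets no interference. *)
exists set0, P1, P2; split => //.
- split; first exact/is_NE_nash.
  case=> Q1 [Q2 [/is_NE_nash /val[r1 r2] [_ _ /=]]].
  have [v1 v2] := valP.
  rewrite -[rate1 _ _ _ Q1 Q2]/(nrate (noise set0 snd Q2) fst Q1) r1 -v1.
  rewrite -[rate2 _ _ _ Q1 Q2]/(nrate (noise (~` set0) fst Q1) snd Q2) r2 -v2.
  by rewrite !ltxx => -[].
- by rewrite p1E; case: valP => v1 _; exact/esym/v1.
- by rewrite p2E; case: valP => _ v2; exact/esym/v2.
Qed.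

Lemma CR2_in_Gs p : is_CR2 f s2 Pb1 Pb2 p -> Gs f s2 Pb1 Pb2 p.
Proof.
move=> [l1 [l2 /= [EP1 EP2 p1E p2E]]].
set P2 := (fun h => _) in EP2; set P1 := (fun h => _) in EP1.
have fin2 : (nrate (cst s2) snd P2 < +oo)%E.
  by have -> : nrate (cst s2) snd P2 = p.2%:E by []; rewrite ltry.
(* The same lemma with the users exchanged: decoding user 1 first on all of [Qpos] means decoding
   user 2 first on its complement, which contains no fading state. *)
have [NE val] := corner_nash hs2 mQ f_ge0 f_meas f_int1 (measurableC mQ)
  (fun x (Dx : Qpos x) h => h Dx) g20 g10 hPb2 hPb1 EP2 EP1 fin2.
have valP := val _ _ NE.
exists Qpos, P1, P2; split => //.
- split; first exact/is_NE_nash/nash_swap.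
  case=> Q1 [Q2 [/is_NE_nash /nash_swap /val[r2 r1] [_ _ /=]]].
  rewrite setCK in r1; have [v2 v1] := valP; rewrite setCK in v1.
  rewrite -[rate1 _ _ _ Q1 Q2]/(nrate (noise Qpos snd Q2) fst Q1) r1 -v1.
  rewrite -[rate2 _ _ _ Q1 Q2]/(nrate (noise (~` Qpos) fst Q1) snd Q2) r2 -v2.
  by rewrite !ltxx => -[].
- by rewrite p1E; case: valP => _; rewrite setCK => v1; exact/esym/v1.
- by rewrite p2E; case: valP => v2 _; exact/esym/v2.
Qed.

Lemma SP_in_Gs p : is_SP f s2 Pb1 Pb2 p -> Gs f s2 Pb1 Pb2 p.
Proof.
move=> [/GcP[P1 [P2 [b1 b2 p1le p2le p12le]]] /Gc_max_sum_rate vmax].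
have [P10 _] := b1; have [P20 _] := b2; have c0 := mpos_cst Qpos hs2.
have sumE : sum_rate fst snd P1 P2 = (p.1 + p.2)%:E.
  by apply/eqP; rewrite eq_le vmax.
have [mA NE r1 r2] := sum_optimal_nash hs2 mQ f_ge0 f_meas f_int1 g10 g20 off_line
  hPb1 hPb2 b1 b2 sumE vmax.
set A := _ `&` _ in mA NE r1 r2.
have sum_nash Q1 Q2 : nash Pb1 Pb2 fst snd A Q1 Q2 -> exists a b : R,
    [/\ nrate (noise A snd Q2) fst Q1 = a%:E,
        nrate (noise (~` A) fst Q1) snd Q2 = b%:E & a + b <= p.1 + p.2].
  move=> [[bQ1 _] [bQ2 _]]; have [Q10 _] := bQ1; have [Q20 _] := bQ2.
  have := vmax _ _ bQ1 bQ2.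
  have Q12 := nrate_sum mu hs2 mQ f_ge0 f_meas mA g10 g20 Q10 Q20.
  have X0 : (0 <= nrate (noise A snd Q2) fst Q1)%E.
    by apply: nrate_ge0 => //; exact: noise_mpos.
  have Y0 : (0 <= nrate (noise (~` A) fst Q1) snd Q2)%E.
    by apply: nrate_ge0 => //; apply: noise_mpos => //; exact: measurableC.
  rewrite -Q12 => Qle.
  have [s sE] := ge0_le_fin (adde_ge0 X0 Y0) Qle.
  have [a [b [aE bE ab]]] := ge0_adde_eq_fin X0 Y0 sE.
  by exists a, b; split => //; move: Qle; rewrite aE bE.
have [a [b [aE bE ab]]] := sum_nash _ _ NE.
(* The equilibrium rates are interference free, hence at least [p.1] and [p.2]; their sum is at most
   [p.1 + p.2], so they are exactly [p]. *)
have pa : p.1 <= a by rewrite -lee_fin -aE r1.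
have pb : p.2 <= b by rewrite -lee_fin -bE r2.
have [ap bp] := le_add_eq pa pb ab.
subst a b.
exists A, P1, P2; split;
  [exact: mA|by move=> h []| |exact: esym aE|exact: esym bE].
split; first exact/is_NE_nash.
case=> Q1 [Q2 [/is_NE_nash /sum_nash[u [v [uE vE uv]]]]].
rewrite /pareto_dom /=.
rewrite -[rate1 _ _ _ Q1 Q2]/(nrate (noise A snd Q2) fst Q1) uE.
rewrite -[rate2 _ _ _ Q1 Q2]/(nrate (noise (~` A) fst Q1) snd Q2) vE.
rewrite -[rate1 _ _ _ P1 P2]/(nrate (noise A snd P2) fst P1) aE.
rewrite -[rate2 _ _ _ P1 P2]/(nrate (noise (~` A) fst P1) snd P2) bE.
rewrite !lee_fin !lte_fin => -[h1 h2 h].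
have : p.1 + p.2 < u + v by case: h => h; [exact: ltr_leD|exact: ler_ltD].
by rewrite ltNge uv.
Qed.

(** The supporting weights are compared. Unequal weights reduce to [boundary_nash], with the users
    exchanged and the decoding set complemented if the second is larger; equal weights express the
    maximality of the sum. *)
Lemma boundary_Gs p : boundary_Gc f s2 Pb1 Pb2 p -> Gs f s2 Pb1 Pb2 p ->
  [\/ is_CR1 f s2 Pb1 Pb2 p, is_CR2 f s2 Pb1 Pb2 p | is_SP f s2 Pb1 Pb2 p].
Proof.
move=> [Gp [mu1 [mu2 [mu10 mu20 mu12 pmax]]]].
move=> [A [P1 [P2 [mA _ [/is_NE_nash NE _] /esym p1E /esym p2E]]]].
case: (ltrgtP mu1 mu2) => [mu_lt|mu_gt|mu_eq].
- have := boundary_nash hs2 mQ f_ge0 f_meas f_int1 (measurableC mA) g20 g10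
    off_line' hPb2 hPb1 mu10 mu_lt ((nash_swap _ _ _ _ _ _ _ _ _).1 NE) p2E.
  rewrite setCK => /(_ _ p1E)[Q2 Q1 b2 b1 q2 q1 q2le q1le||].
  + rewrite ![mu2 * _ + _]addrC.
    exact: pmax (q1, q2) (Gc_decode1 b1 b2 q1le q2le).
  + move=> [l2 [l1 [E2 E1 r2 r1]]]; apply: Or32.
    by exists l1, l2; split.
  + move=> smax; apply: Or33; apply: is_SP_of_sum_rate => // Q1 Q2 b1 b2.
    by rewrite addrC sum_rateC smax.
- have := boundary_nash hs2 mQ f_ge0 f_meas f_int1 mA g10 g20
    off_line hPb1 hPb2 mu20 mu_gt NE p1E p2E.
  move=> [Q1 Q2 b1 b2 q1 q2 q1le q2le||].
  + exact: pmax (q1, q2) (Gc_decode2 b1 b2 q1le q2le).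
  + move=> [l1 [l2 [E1 E2 r1 r2]]]; apply: Or31.
    by exists l1, l2; split.
  + by move=> smax; apply: Or33; exact: is_SP_of_sum_rate.
- apply: Or33; split=> // q /pmax; rewrite mu_eq -!mulrDr ler_pM2l//.
  by rewrite lt0r mu20 andbT; move: mu12; rewrite mu_eq orbb.
Qed.

End capacity_region.

Unset Implicit Arguments. Set Strict Implicit. Set Printing Implicit Defensive.

Theorem theorem4 (R : realType) (f : R * R -> R) (s2 Pb1 Pb2 : R)
  (hs2 : 0 < s2) (hPb1 : 0 < Pb1) (hPb2 : 0 < Pb2)
  (f_ge0 : forall h, Qpos h -> 0 <= f h)
  (f_meas : measurable_fun Qpos f)
  (f_cont : {within Qpos, continuous f})
  (f_bnd : exists M : R, forall h, Qpos h -> f h <= M)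
  (f_int1 : (\int[leb2]_(h in Qpos) (f h)%:E = 1)%E) :
  [/\ (forall p, is_CR1 f s2 Pb1 Pb2 p -> Gs f s2 Pb1 Pb2 p),
      (forall p, is_CR2 f s2 Pb1 Pb2 p -> Gs f s2 Pb1 Pb2 p),
      (forall p, is_SP f s2 Pb1 Pb2 p -> Gs f s2 Pb1 Pb2 p)
    & (forall p, boundary_Gc f s2 Pb1 Pb2 p -> Gs f s2 Pb1 Pb2 p ->
         [\/ is_CR1 f s2 Pb1 Pb2 p, is_CR2 f s2 Pb1 Pb2 p | is_SP f s2 Pb1 Pb2 p])].
Proof.
split=> p.
- exact: CR1_in_Gs.
- exact: CR2_in_Gs.
- exact: SP_in_Gs.
- exact: boundary_Gs.
Qed.
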